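(* Let $(A,\mathfrak m_A)\subseteq (B,\mathfrak m_B)$ be a faithfully flat ring extension of Noetherian local rings. Assume that the extension is Weierstrass and that the ring $B$ is henselian. Denote by $A^h$ the Henselization of $A$. Then there are faithfully flat embeddings $A\hookrightarrow A^h\hookrightarrow B$ whose composition is the inclusion $A\subseteq B$. If $B$ is not a principal ideal ring, then there are faithfully flat embeddings $A^h\hookrightarrow B\hookrightarrow \hat A$, where $\hat A$ is the $\mathfrak m_A$-adic completion of $A$. Moreover, the Henselization $A\hookrightarrow A^h$ is Weierstrass.
   Context: All rings are commutative with a unit. A ring homomorphism $\varphi: A\rightarrow B$ is called Weierstrass if for every $b\in B$ there are an element $a\in A$ and a unit $b'\in B^\times$ such that $b=\varphi(a)b'$; if $A\subseteq B$ is a subring and the inclusion is Weierstrass, the extension is called a Weierstrass extension. A principal ideal ring is a ring (not necessarily a domain) all of whose ideals are principal. *)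

(* Defs.v *)
From HB Require Import structures.
From mathcomp Require Import all_boot all_algebra.
From mathcomp Require Import boolp classical_sets.

Set Implicit Arguments.
Unset Strict Implicit.
Unset Printing Implicit Defensive.

Import GRing.Theory.

Local Open Scope classical_set_scope.
Local Open Scope quotient_scope.
Local Open Scope ring_scope.

(* [comPzRingType] is the type of all commutative rings with a unit;           *)
(* [comNzRingType] adds 1 != 0, which local rings satisfy. MathComp's [idealr] *)
(* only has proper ideals, hence the type [ideal] of all ideals below.         *)

Identity Coercion fun_of_set : set >-> Funclass.

Section Ideals.
Variable R : comPzRingType.
Implicit Types (X : set R) (a b x y : R).

Definition is_ideal X : Prop :=
  [/\ X 0, (forall x y, X x -> X y -> X (x + y)) & forall a x, X x -> X (a * x)].

Record ideal := Ideal { ideal_set :> set R ; idealP : is_ideal ideal_set }.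

Definition generated X : set R :=
  [set x | forall J : ideal, X `<=` J -> J x].

Lemma generated_is_ideal X : is_ideal (generated X).
Proof.
split=> [J _|x y Xx Xy J XJ|a x Xx J XJ]; case: (idealP J) => J0 JD JM //.
- by apply: JD; [apply: Xx|apply: Xy].
- by apply: JM; apply: Xx.
Qed.

Definition ideal_gen X : ideal := Ideal (generated_is_ideal X).

Definition ideal_mul (I J : ideal) : ideal :=
  ideal_gen [set x | exists a b, [/\ I a, J b & x = a * b]].

Definition ideal_pow (I : ideal) (n : nat) : ideal :=
  iter n (ideal_mul I) (ideal_gen setT).

Definition maximal (m : ideal) : Prop :=
  m <> setT :> set R /\
  forall J : ideal, m `<=` J -> J = m :> set R \/ J = setT :> set R.

Definition local_ring (m : ideal) : Prop :=
  maximal m /\ forall n : ideal, maximal n -> n = m :> set R.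

Definition noetherian : Prop :=
  forall I : ideal, exists s : seq R, I = ideal_gen [set x | x \in s] :> set R.

Definition principal_ideal_ring : Prop :=
  forall I : ideal, exists a : R, I = ideal_gen [set a] :> set R.

Definition is_unit a : Prop := exists b, a * b = 1.

End Ideals.

Arguments noetherian : clear implicits.
Arguments principal_ideal_ring : clear implicits.

Definition weierstrass (A B : comPzRingType) (phi : {rmorphism A -> B}) : Prop :=
  forall b : B, exists (a : A) (b' : B), is_unit b' /\ b = phi a * b'.

Definition local_hom (A B : comPzRingType) (mA : ideal A) (mB : ideal B)
    (phi : {rmorphism A -> B}) : Prop :=
  forall x, mA x -> mB (phi x).

(* Simple roots of monic polynomials in the residue field R / m lift to R; the *)
(* root in R / m is given by a representative [a0].                            *)
Definition henselian (R : comNzRingType) (m : ideal R) : Prop :=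
  local_ring m /\
  forall (f : {poly R}) (a0 : R), f \is monic ->
    m f.[a0] -> ~ m f^`().[a0] -> exists2 a : R, f.[a] = 0 & m (a - a0).

(* The universal property of A -> A^h among local homomorphisms from A to      *)
(* henselian local rings.                                                      *)
Definition is_henselization (A Ah : comNzRingType) (mA : ideal A) (mH : ideal Ah)
    (i : {rmorphism A -> Ah}) : Prop :=
  [/\ henselian mH, local_hom mA mH i &
      forall (C : comNzRingType) (mC : ideal C) (f : {rmorphism A -> C}),
        henselian mC -> local_hom mA mC f ->
        exists g : {rmorphism Ah -> C},
          [/\ local_hom mH mC g, g \o i =1 f &
              forall g' : {rmorphism Ah -> C},
                local_hom mH mC g' -> g' \o i =1 f -> g' =1 g]].

Section QuotientRing.
Variables (R : comPzRingType) (I : ideal R).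

Definition ideal_pred : {pred R} := fun x => `[< I x >].

Lemma ideal_pred_zmod_closed : zmod_closed ideal_pred.
Proof.
case: (idealP I) => I0 ID IM; split=> [|x y /asboolP Ix /asboolP Iy].
  exact/asboolP.
by apply/asboolP; apply: ID => //; rewrite -mulN1r; apply: IM.
Qed.

HB.instance Definition _ := GRing.isZmodClosed.Build R ideal_pred
  ideal_pred_zmod_closed.

Definition ideal_zmodClosed : zmodClosed R := ideal_pred.

Definition quot_ring : Type := {ideal_quot ideal_zmodClosed}.
HB.instance Definition _ := GRing.Zmodule.on quot_ring.
HB.instance Definition _ := Quotient.on quot_ring.

Definition quot_pi (x : R) : quot_ring := \pi_quot_ring x.

Lemma quot_piP x y : quot_pi x = quot_pi y <-> I (x - y).
Proof.
rewrite /quot_pi; split=> [/eqP|Ixy].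
  by rewrite -[_ == _]/(x == y %[mod {ideal_quot ideal_zmodClosed}]) -Quotient.idealrBE
    => /asboolP.
apply/eqP; rewrite -[_ == _]/(x == y %[mod {ideal_quot ideal_zmodClosed}]).
by rewrite -Quotient.idealrBE; apply/asboolP.
Qed.

Lemma quot_piK (x : quot_ring) : quot_pi (repr x) = x.
Proof. exact: reprK. Qed.

Lemma quot_piB : zmod_morphism quot_pi.
Proof. by move=> x y; rewrite /quot_pi; exact: (raddfB \pi_{ideal_quot ideal_zmodClosed}). Qed.

HB.instance Definition _ := GRing.isZmodMorphism.Build R quot_ring quot_pi quot_piB.

Definition quot_one : quot_ring := quot_pi 1.
Definition quot_mul (x y : quot_ring) : quot_ring := quot_pi (repr x * repr y).

Lemma quot_mulE x y : quot_mul (quot_pi x) (quot_pi y) = quot_pi (x * y).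
Proof.
apply/quot_piP; set x' := repr _; set y' := repr _.
have /quot_piP Ix : quot_pi x' = quot_pi x by rewrite quot_piK.
have /quot_piP Iy : quot_pi y' = quot_pi y by rewrite quot_piK.
case: (idealP I) => _ ID IM.
have -> : x' * y' - x * y = y' * (x' - x) + x * (y' - y).
  by rewrite !mulrBr [y' * x']mulrC [y' * x]mulrC addrA subrK.
by apply: ID; apply: IM.
Qed.

Lemma quot_mulA : associative quot_mul.
Proof.
by move=> x y z; rewrite -(quot_piK x) -(quot_piK y) -(quot_piK z) !quot_mulE mulrA.
Qed.

Lemma quot_mulC : commutative quot_mul.
Proof. by move=> x y; rewrite -(quot_piK x) -(quot_piK y) !quot_mulE mulrC. Qed.

Lemma quot_mul1 : left_id quot_one quot_mul.
Proof. by move=> x; rewrite -(quot_piK x) quot_mulE mul1r. Qed.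

Lemma quot_mulDl : left_distributive quot_mul +%R.
Proof.
move=> x y z; rewrite -(quot_piK x) -(quot_piK y) -(quot_piK z).
by rewrite -raddfD !quot_mulE mulrDl raddfD.
Qed.

HB.instance Definition _ := GRing.Zmodule_isComPzRing.Build quot_ring
  quot_mulA quot_mulC quot_mul1 quot_mulDl.

Lemma quot_pi_monoid_morphism : monoid_morphism quot_pi.
Proof. by split=> // x y; rewrite -quot_mulE. Qed.

HB.instance Definition _ := GRing.isMonoidMorphism.Build R quot_ring quot_pi
  quot_pi_monoid_morphism.

End QuotientRing.

(* The I-adic completion, as the inverse limit of the rings R / I^n: families  *)
(* of residue classes such that the class at n.+1 is included in the class     *)
(* at n.                                                                       *)
Section Completion.
Variables (R : comPzRingType) (I : ideal R).

Local Notation Q n := (quot_ring (ideal_pow I n)).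

Definition adic_compatible (x : forall n, Q n) : Prop :=
  forall n (a : R), quot_pi (ideal_pow I n.+1) a = x n.+1 ->
    quot_pi (ideal_pow I n) a = x n.

Record adic_completion : Type :=
  Adic { adic_val :> forall n, Q n ; adicP : adic_compatible adic_val }.

HB.instance Definition _ := gen_eqMixin adic_completion.
HB.instance Definition _ := gen_choiceMixin adic_completion.

Lemma adic_ext (x y : adic_completion) : (forall n, x n = y n) -> x = y.
Proof.
case: x y => [x xP] [y yP] /= exy.
have {}exy : x = y by apply: functional_extensionality_dep.
by subst y; congr Adic; apply: Prop_irrelevance.
Qed.

Lemma ideal_pow_sub n : ideal_pow I n.+1 `<=` ideal_pow I n.
Proof.
move=> x; apply=> y [a [b [_ Jb ->]]].
by case: (idealP (ideal_pow I n)) => _ _; apply.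
Qed.

Lemma adic_compatibleW (x : forall n, Q n) :
  (forall n, exists2 a, quot_pi (ideal_pow I n.+1) a = x n.+1 &
                        quot_pi (ideal_pow I n) a = x n) ->
  adic_compatible x.
Proof.
move=> xP n b; have [a <- <-] := xP n => /quot_piP Iab.
exact/quot_piP/ideal_pow_sub.
Qed.

Lemma adic_repr (x : adic_completion) n :
  exists2 a, quot_pi (ideal_pow I n.+1) a = x n.+1 &
             quot_pi (ideal_pow I n) a = x n.
Proof.
by exists (repr (x n.+1)); [|apply: adicP]; rewrite quot_piK.
Qed.

Lemma adic_zero_subproof : adic_compatible (fun n => 0).
Proof. by apply: adic_compatibleW => n; exists 0; rewrite raddf0. Qed.

Lemma adic_opp_subproof (x : adic_completion) : adic_compatible (fun n => - x n).
Proof.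
apply: adic_compatibleW => n; have [a ea eb] := adic_repr x n.
by exists (- a); rewrite raddfN /= ?ea ?eb.
Qed.

Lemma adic_add_subproof (x y : adic_completion) :
  adic_compatible (fun n => x n + y n).
Proof.
apply: adic_compatibleW => n.
have [a ea eb] := adic_repr x n; have [c ec ed] := adic_repr y n.
by exists (a + c); rewrite raddfD /= ?ea ?ec ?eb ?ed.
Qed.

Lemma adic_of_subproof (a : R) :
  adic_compatible (fun n => quot_pi (ideal_pow I n) a).
Proof. by apply: adic_compatibleW => n; exists a. Qed.

Lemma adic_mul_subproof (x y : adic_completion) :
  adic_compatible (fun n => x n * y n).
Proof.
apply: adic_compatibleW => n.
have [a ea eb] := adic_repr x n; have [c ec ed] := adic_repr y n.
by exists (a * c); rewrite rmorphM /= ?ea ?ec ?eb ?ed.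
Qed.

Definition adic_zero : adic_completion := Adic adic_zero_subproof.
Definition adic_opp x : adic_completion := Adic (@adic_opp_subproof x).
Definition adic_add x y : adic_completion := Adic (@adic_add_subproof x y).
Definition adic_mul x y : adic_completion := Adic (@adic_mul_subproof x y).
Definition adic_of (a : R) : adic_completion := Adic (@adic_of_subproof a).

Lemma adic_addA : associative adic_add.
Proof. by move=> x y z; apply: adic_ext => n /=; rewrite addrA. Qed.
Lemma adic_addC : commutative adic_add.
Proof. by move=> x y; apply: adic_ext => n /=; rewrite addrC. Qed.
Lemma adic_add0 : left_id adic_zero adic_add.
Proof. by move=> x; apply: adic_ext => n /=; rewrite add0r. Qed.
Lemma adic_addN : left_inverse adic_zero adic_opp adic_add.
Proof. by move=> x; apply: adic_ext => n /=; rewrite addNr. Qed.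

HB.instance Definition _ := GRing.isZmodule.Build adic_completion
  adic_addA adic_addC adic_add0 adic_addN.

Lemma adic_mulA : associative adic_mul.
Proof. by move=> x y z; apply: adic_ext => n /=; rewrite mulrA. Qed.
Lemma adic_mulC : commutative adic_mul.
Proof. by move=> x y; apply: adic_ext => n /=; rewrite mulrC. Qed.
Lemma adic_mul1 : left_id (adic_of 1) adic_mul.
Proof. by move=> x; apply: adic_ext => n /=; rewrite rmorph1 mul1r. Qed.
Lemma adic_mulDl : left_distributive adic_mul +%R.
Proof. by move=> x y z; apply: adic_ext => n /=; rewrite mulrDl. Qed.

HB.instance Definition _ := GRing.Zmodule_isComPzRing.Build adic_completion
  adic_mulA adic_mulC adic_mul1 adic_mulDl.

Lemma adic_of_zmod_morphism : zmod_morphism adic_of.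
Proof. by move=> a b; apply: adic_ext => n /=; rewrite raddfB. Qed.

Lemma adic_of_monoid_morphism : monoid_morphism adic_of.
Proof. by split=> // a b; apply: adic_ext => n /=; rewrite rmorphM. Qed.

HB.instance Definition _ := GRing.isZmodMorphism.Build R adic_completion adic_of
  adic_of_zmod_morphism.
HB.instance Definition _ := GRing.isMonoidMorphism.Build R adic_completion adic_of
  adic_of_monoid_morphism.

End Completion.

(* The tensor product M (x)_A N, as the quotient of the monoid of formal sums  *)
(* of pairs (m, n), i.e. sequences of pairs up to reordering, by the           *)
(* congruence that bilinearity generates.                                      *)
Section Tensor.
Variables (A : comPzRingType) (M N : lmodType A).

Inductive tensor_eq : seq (M * N) -> seq (M * N) -> Prop :=
| tensor_refl s : tensor_eq s s
| tensor_sym s t : tensor_eq s t -> tensor_eq t s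
| tensor_trans s t u : tensor_eq s t -> tensor_eq t u -> tensor_eq s u
| tensor_cat s s' t t' :
    tensor_eq s s' -> tensor_eq t t' -> tensor_eq (s ++ t) (s' ++ t')
| tensor_catC s t : tensor_eq (s ++ t) (t ++ s)
| tensor_0l n : tensor_eq [:: (0, n)] [::]
| tensor_Dl m m' n : tensor_eq [:: (m + m', n)] [:: (m, n); (m', n)]
| tensor_Dr m n n' : tensor_eq [:: (m, n + n')] [:: (m, n); (m, n')]
| tensor_Z a m n : tensor_eq [:: (a *: m, n)] [:: (m, a *: n)].

Definition tensor_rel : rel (seq (M * N)) := fun s t => `[< tensor_eq s t >].

Lemma tensor_rel_equiv : equiv_class_of tensor_rel.
Proof.
split=> [s|s t|t s u].
- exact/asboolP/tensor_refl.
- by apply/asboolP/asboolP; apply: tensor_sym.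
- move=> /asboolP st /asboolP tu; apply/asboolP.
  exact: tensor_trans st tu.
Qed.

Canonical tensor_rel_equivRel := EquivRelPack tensor_rel_equiv.

Definition tensor : Type := {eq_quot tensor_rel}.
HB.instance Definition _ := Choice.on tensor.
HB.instance Definition _ := Quotient.on tensor.

Definition tensor_pi (s : seq (M * N)) : tensor := \pi_tensor s.

Definition pure_tensor (m : M) (n : N) : tensor := tensor_pi [:: (m, n)].

Lemma tensor_piP s t : tensor_pi s = tensor_pi t <-> tensor_eq s t.
Proof.
split=> [/eqmodP/asboolP //|st].
by apply/eqmodP/asboolP.
Qed.

Lemma tensor_piK x : tensor_pi (repr x) = x. Proof. exact: reprK. Qed.

Lemma tensor_repr_pi s : tensor_eq (repr (tensor_pi s)) s.
Proof. by apply/tensor_piP; rewrite tensor_piK. Qed.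

Definition tensor_scale_seq (a : A) (s : seq (M * N)) : seq (M * N) :=
  [seq (a *: p.1, p.2) | p <- s].

Definition tensor_add (x y : tensor) : tensor := tensor_pi (repr x ++ repr y).
Definition tensor_scale (a : A) (x : tensor) : tensor :=
  tensor_pi (tensor_scale_seq a (repr x)).

Lemma tensor_addE s t : tensor_add (tensor_pi s) (tensor_pi t) = tensor_pi (s ++ t).
Proof. by apply/tensor_piP; apply: tensor_cat; apply: tensor_repr_pi. Qed.

Lemma tensor_eq_scale a s t :
  tensor_eq s t -> tensor_eq (tensor_scale_seq a s) (tensor_scale_seq a t).
Proof.
elim=> {s t} [s|s t _|s t u _ st _|s s' t t' _ ss' _ tt'|s t|n|m m' n|m n n'|b m n].
- exact: tensor_refl.
- exact: tensor_sym.
- exact: tensor_trans st.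
- by rewrite /tensor_scale_seq !map_cat; apply: tensor_cat.
- by rewrite /tensor_scale_seq !map_cat; apply: tensor_catC.
- by rewrite /= scaler0; apply: tensor_0l.
- by rewrite /= scalerDr; apply: tensor_Dl.
- exact: tensor_Dr.
- by rewrite /= scalerA mulrC -scalerA; apply: tensor_Z.
Qed.

Lemma tensor_scaleE a s :
  tensor_scale a (tensor_pi s) = tensor_pi (tensor_scale_seq a s).
Proof. exact/tensor_piP/tensor_eq_scale/tensor_repr_pi. Qed.

Lemma tensor_addA : associative tensor_add.
Proof.
move=> x y z; rewrite -(tensor_piK x) -(tensor_piK y) -(tensor_piK z).
by rewrite !tensor_addE catA.
Qed.

Lemma tensor_addC : commutative tensor_add.
Proof. by move=> x y; apply/tensor_piP/tensor_catC. Qed.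

Lemma tensor_add0 : left_id (tensor_pi [::]) tensor_add.
Proof. by move=> x; rewrite -(tensor_piK x) tensor_addE. Qed.

Lemma tensor_scale_seqDl a b s :
  tensor_eq (tensor_scale_seq (a + b) s)
            (tensor_scale_seq a s ++ tensor_scale_seq b s).
Proof.
elim: s => [|[m n] s IHs] /=; first exact: tensor_refl.
rewrite -[_ :: tensor_scale_seq (a + b) s]cat1s scalerDl.
apply: tensor_trans (tensor_cat (tensor_Dl _ _ _) IHs) _.
rewrite -[_ :: (_ ++ _)]cat1s -[_ :: tensor_scale_seq b s]cat1s.
rewrite -[[:: _; _]](cat1s _ [:: _]) -!catA.
apply: tensor_cat; first exact: tensor_refl.
rewrite !catA; apply: tensor_cat; last exact: tensor_refl.
exact: tensor_catC.
Qed.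

Lemma tensor_scale_seq0 s : tensor_eq (tensor_scale_seq 0 s) [::].
Proof.
elim: s => [|[m n] s IHs] /=; first exact: tensor_refl.
by rewrite -cat1s scale0r; apply: (tensor_cat (tensor_0l _) IHs).
Qed.

Definition tensor_opp (x : tensor) : tensor := tensor_scale (-1) x.

Lemma tensor_scale_seq1 s : tensor_scale_seq 1 s = s.
Proof. by elim: s => //= -[m n] s ->; rewrite scale1r. Qed.

Lemma tensor_addN : left_inverse (tensor_pi [::]) tensor_opp tensor_add.
Proof.
move=> x; rewrite -(tensor_piK x) /tensor_opp tensor_scaleE tensor_addE.
apply/tensor_piP; rewrite -{2}(tensor_scale_seq1 (repr x)).
apply: tensor_trans (tensor_sym (tensor_scale_seqDl _ _ _)) _.
by rewrite addNr; apply: tensor_scale_seq0.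
Qed.

HB.instance Definition _ := GRing.isZmodule.Build tensor
  tensor_addA tensor_addC tensor_add0 tensor_addN.

Lemma tensor_piD s t : tensor_pi (s ++ t) = tensor_pi s + tensor_pi t.
Proof. by rewrite -tensor_addE. Qed.

Lemma tensor_scaleA a b x : tensor_scale a (tensor_scale b x) = tensor_scale (a * b) x.
Proof.
rewrite -(tensor_piK x) !tensor_scaleE /tensor_scale_seq -map_comp.
by congr tensor_pi; apply: eq_map => p /=; rewrite scalerA.
Qed.

Lemma tensor_scale1 : left_id 1 tensor_scale.
Proof. by move=> x; rewrite -(tensor_piK x) tensor_scaleE tensor_scale_seq1. Qed.

Lemma tensor_scaleDr : right_distributive tensor_scale +%R.
Proof.
move=> a x y; rewrite -(tensor_piK x) -(tensor_piK y) -tensor_piD !tensor_scaleE.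
by rewrite /tensor_scale_seq map_cat tensor_piD.
Qed.

Lemma tensor_scaleDl x : {morph tensor_scale^~ x : a b / a + b}.
Proof.
move=> a b; rewrite -(tensor_piK x) !tensor_scaleE -tensor_piD.
exact/tensor_piP/tensor_scale_seqDl.
Qed.

HB.instance Definition _ := GRing.Zmodule_isLmodule.Build A tensor
  tensor_scaleA tensor_scale1 tensor_scaleDr tensor_scaleDl.

End Tensor.

(* u (x) id : M (x) N -> M' (x) N. *)
Section TensorMap.
Variables (A : comPzRingType) (M M' N : lmodType A) (u : {linear M -> M'}).

Definition tensor_map_seq (s : seq (M * N)) : seq (M' * N) :=
  [seq (u p.1, p.2) | p <- s].

Definition tensor_map (x : tensor M N) : tensor M' N :=
  tensor_pi (tensor_map_seq (repr x)).

Lemma tensor_eq_map s t :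
  tensor_eq s t -> tensor_eq (tensor_map_seq s) (tensor_map_seq t).
Proof.
elim=> {s t} [s|s t _|s t w _ st _|s s' t t' _ ss' _ tt'|s t|n|m m' n|m n n'|b m n].
- exact: tensor_refl.
- exact: tensor_sym.
- exact: tensor_trans st.
- by rewrite /tensor_map_seq !map_cat; apply: tensor_cat.
- by rewrite /tensor_map_seq !map_cat; apply: tensor_catC.
- by rewrite /= linear0; apply: tensor_0l.
- by rewrite /= linearD; apply: tensor_Dl.
- exact: tensor_Dr.
- by rewrite /= linearZ; apply: tensor_Z.
Qed.

Lemma tensor_mapE s : tensor_map (tensor_pi s) = tensor_pi (tensor_map_seq s).
Proof. exact/tensor_piP/tensor_eq_map/tensor_repr_pi. Qed.

Lemma tensor_map_pure m n :
  tensor_map (pure_tensor m n) = pure_tensor (u m) n.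
Proof. exact: tensor_mapE. Qed.

Lemma tensor_map_linear : linear tensor_map.
Proof.
move=> a x y; rewrite -(tensor_piK x) -(tensor_piK y).
rewrite -[a *: _]/(tensor_scale a _) tensor_scaleE -tensor_piD !tensor_mapE.
rewrite -[a *: _]/(tensor_scale a _) tensor_scaleE -tensor_piD.
congr tensor_pi; rewrite /tensor_map_seq /tensor_scale_seq map_cat -!map_comp.
by congr (_ ++ _); apply: eq_map => p /=; rewrite linearZ.
Qed.

HB.instance Definition _ := GRing.isLinear.Build A (tensor M N) (tensor M' N) _
  tensor_map tensor_map_linear.

End TensorMap.

Arguments tensor_map {A M M'} N u.

Definition restrict_scalars (A B : comPzRingType) (phi : {rmorphism A -> B}) : Type :=
  B.

Section RestrictScalars.
Variables (A B : comPzRingType) (phi : {rmorphism A -> B}).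
Local Notation restr := (restrict_scalars phi).

HB.instance Definition _ := GRing.Zmodule.copy restr B.

Definition restrict_scale (a : A) (b : restr) : restr := phi a * (b : B).

Lemma restrict_scaleA a b v :
  restrict_scale a (restrict_scale b v) = restrict_scale (a * b) v.
Proof. by rewrite /restrict_scale rmorphM mulrA. Qed.
Lemma restrict_scale1 : left_id 1 restrict_scale.
Proof. by move=> v; rewrite /restrict_scale rmorph1 mul1r. Qed.
Lemma restrict_scaleDr : right_distributive restrict_scale +%R.
Proof. by move=> a u v; rewrite /restrict_scale mulrDr. Qed.
Lemma restrict_scaleDl v : {morph restrict_scale^~ v : a b / a + b}.
Proof. by move=> a b; rewrite /restrict_scale rmorphD mulrDl. Qed.

HB.instance Definition _ := GRing.Zmodule_isLmodule.Build A restr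
  restrict_scaleA restrict_scale1 restrict_scaleDr restrict_scaleDl.

Lemma restrict_scaleE (a : A) (b : restr) : a *: b = phi a * (b : B) :> B.
Proof. by []. Qed.

End RestrictScalars.

Definition exact_seq (U V W : Type) (z : W) (u : U -> V) (v : V -> W) : Prop :=
  forall y : V, v y = z <-> exists x : U, u x = y.

(* A sequence of A-modules is exact if and only if its tensor product with the *)
(* A-module B is.                                                              *)
Definition faithfully_flat (A B : comPzRingType) (phi : {rmorphism A -> B}) : Prop :=
  forall (N1 N2 N3 : lmodType A) (u : {linear N1 -> N2}) (v : {linear N2 -> N3}),
    exact_seq 0 u v <->
    exact_seq 0 (tensor_map (restrict_scalars phi) u)
                (tensor_map (restrict_scalars phi) v).

Definition ff_embedding (A B : comPzRingType) (phi : {rmorphism A -> B}) : Prop :=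
  injective phi /\ faithfully_flat phi.

(* Main.v *)
(** Over a faithfully flat Weierstrass extension, flatness is handled through
    the equational criterion, relative to a set of allowed coefficients.

    Henselization: among the subrings T of A^h that contain A, are closed under
    inverses, and over which B is flat through j : A^h -> B, take a maximal one.
    Adjoining to T a simple root (and inverses of units) preserves flatness of
    B, since B already splits off that root; hence T contains all such roots
    and is henselian. The universal property then retracts A^h onto T, so
    T = A^h. Thus B is faithfully flat over A^h, and both the flatness of
    A -> A^h and its Weierstrass property descend from B.

    Completion: if B is not principal, some ideal (x, y)B with x, y in A is not
    principal. For b in B the Weierstrass property gives x + b y = a u with
    a in A, u a unit, and a in (x, y)A by faithful flatness; comparing
    coefficients yields b = d / c modulo m_B with c, d in A. So A and B have the
    same residue field and B embeds in the completion of A. The completion is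
    flat over A by a weak Artin-Rees lemma, which follows from the ascending
    chain condition by induction on the generators of m_A; writing elements of
    B as a u transfers flatness to B. *)

From HB Require Import structures.
From Stdlib Require List.
Require Import Defs.
From mathcomp Require Import all_boot all_algebra.
From mathcomp Require Import ring boolp classical_sets.

Set Implicit Arguments.
Unset Strict Implicit.
Unset Printing Implicit Defensive.

Import GRing.Theory.
Local Open Scope classical_set_scope.
Local Open Scope ring_scope.

(** * Flatness by the equational criterion *)

Section Pure.
Variables (A : comPzRingType) (M N : lmodType A).
Implicit Types (m : M) (n : N).

Lemma tensor_pi_sum (s : seq (M * N)) :
  tensor_pi s = \sum_(p <- s) pure_tensor p.1 p.2.
Proof.
elim: s => [|[m n] s IHs]; first by rewrite big_nil.
by rewrite big_cons -IHs -cat1s tensor_piD.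
Qed.

Lemma pure_tensorDl n : {morph (fun m => pure_tensor m n) : m m' / m + m'}.
Proof. by move=> m m'; rewrite -tensor_piD; apply/tensor_piP/tensor_Dl. Qed.

Lemma pure_tensorDr m : {morph (fun n => pure_tensor m n) : n n' / n + n'}.
Proof. by move=> n n'; rewrite -tensor_piD; apply/tensor_piP/tensor_Dr. Qed.

Lemma pure_tensorZ a m n : pure_tensor (a *: m) n = pure_tensor m (a *: n).
Proof. exact/tensor_piP/tensor_Z. Qed.

Lemma pure_tensor0l n : pure_tensor 0 n = 0 :> tensor M N.
Proof. exact/tensor_piP/tensor_0l. Qed.

Lemma pure_tensor0r m : pure_tensor m 0 = 0 :> tensor M N.
Proof. by rewrite -(scale0r 0) -pure_tensorZ scale0r pure_tensor0l. Qed.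

Lemma pure_tensor_sumr I (r : seq I) (F : I -> N) m :
  pure_tensor m (\sum_(i <- r) F i) = \sum_(i <- r) pure_tensor m (F i).
Proof. exact: (big_morph _ (pure_tensorDr m) (pure_tensor0r m)). Qed.

End Pure.

(** The equational criterion for flatness. When [T] is a subring, this is flatness of [S] over [T],
    with no ring type built on [T]. Arbitrary finite index types allow families to be glued along
    sums of types. *)
Definition flat_on (R S : comPzRingType) (T : set R) (phi : {rmorphism R -> S}) :=
  forall (I : finType) (a : I -> R) (x : I -> S),
    (forall i, T (a i)) -> \sum_i phi (a i) * x i = 0 ->
    exists (J : finType) (W : I -> J -> R) (y : J -> S),
      [/\ forall i l, T (W i l), forall i, x i = \sum_l phi (W i l) * y l
        & forall l, \sum_i a i * W i l = 0].

(** No proper finitely generated ideal of [R] extends to the unit ideal of [S]: the faithful half of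
    faithful flatness. *)
Definition reflects_unimodular (R S : comPzRingType) (phi : {rmorphism R -> S}) :=
  forall (J : finType) (c : J -> R) (z : J -> S),
    \sum_j phi (c j) * z j = 1 -> exists d : J -> R, \sum_j c j * d j = 1.

Section System.
Variables (R S : comPzRingType) (T : set R) (phi : {rmorphism R -> S}).
Hypotheses (T0 : T 0) (T1 : T 1).
Hypotheses (TD : forall x y, T x -> T y -> T (x + y)).
Hypotheses (TM : forall x y, T x -> T y -> T (x * y)).
Hypothesis flatT : flat_on T phi.

(** Relations are solved one after another: once [x] is factored through [y], the next relation on
    [x] becomes a relation on [y], and the two factorizations compose. *)
Lemma flat_on_system (I : finType) (x : I -> S) (rs : seq (I -> R)) :
  (forall r, List.In r rs -> (forall i, T (r i)) /\ \sum_i phi (r i) * x i = 0) ->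
  exists (J : finType) (W : I -> J -> R) (y : J -> S),
    [/\ forall i l, T (W i l), forall i, x i = \sum_l phi (W i l) * y l
      & forall r, List.In r rs -> forall l, \sum_i r i * W i l = 0].
Proof.
elim: rs => [_|r rs IHrs rsP].
  exists I, (fun i l => (i == l)%:R), x; split=> // [i l|i]; first by case: (i == l).
  rewrite (bigD1 i) //= eqxx rmorph1 mul1r big1 ?addr0 // => l.
  by rewrite eq_sym => /negPf->; rewrite rmorph0 mul0r.
have [|J [W [y [TW xW rsW]]]] := IHrs; first by move=> r' r's; apply: rsP; right.
have [Tr rx] := rsP r (or_introl erefl).
have [||K [V [z [TV yV rV]]]] := flatT (a := fun l => \sum_i r i * W i l) (x := y).
- move=> l; apply: (big_ind T) => // i _; exact: TM.
- rewrite -[RHS]rx; under eq_bigr => l _ do rewrite rmorph_sum mulr_suml.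
  rewrite exchange_big /=; apply: eq_bigr => i _; rewrite xW mulr_sumr.
  by apply: eq_bigr => l _; rewrite rmorphM mulrA.
exists K, (fun i k => \sum_l W i l * V l k), z.
have rVE (q : I -> R) k : \sum_i q i * (\sum_l W i l * V l k)
   = \sum_l (\sum_i q i * W i l) * V l k.
  under eq_bigr => i _ do rewrite mulr_sumr.
  rewrite exchange_big /=; apply: eq_bigr => l _; rewrite mulr_suml.
  by apply: eq_bigr => i _; rewrite mulrA.
split=> [i k|i|q].
- by apply: (big_ind T) => // l _; apply: TM.
- rewrite xW; under eq_bigr => l _ do rewrite yV mulr_sumr.
  rewrite exchange_big /=; apply: eq_bigr => k _; rewrite rmorph_sum mulr_suml.
  by apply: eq_bigr => l _; rewrite rmorphM mulrA.
- case=> [<-|qrs] k; rewrite rVE; first exact: rV.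
  by rewrite big1 // => l _; rewrite rsW // mul0r.
Qed.

End System.

(** * Equality of tensors over a flat module *)

Section TensorFlat.
Variables (A S : comPzRingType) (phi : {rmorphism A -> S}).
Local Notation N := (restrict_scalars phi).

Section Factor.
Variable M : lmodType A.

(* The formal sum s becomes sum_j (w j, y j) when the second components are    *)
(* expanded as A-combinations of y. For S flat over A, two formal sums are     *)
(* equal tensors exactly when they have such an expansion in common.           *)
Fixpoint tensor_factor (J : finType) (y : J -> S) (s : seq (M * N)) (w : J -> M) :
    Prop :=
  if s is (m, n) :: s' then
    exists (c : J -> A) (w' : J -> M),
      [/\ (n : S) = \sum_j phi (c j) * y j, tensor_factor y s' w'
        & forall j, w j = c j *: m + w' j]
  else forall j, w j = 0.

Lemma tensor_factor_pi (J : finType) (y : J -> S) s w :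
  tensor_factor y s w -> tensor_pi s = \sum_j pure_tensor (w j) (y j : N).
Proof.
elim: s w => [|[m n] s IHs] w /=.
  by move=> w0; rewrite big1 // => j _; rewrite w0 pure_tensor0l.
case=> c [w' [nE /IHs sE wE]]; rewrite -cat1s tensor_piD sE.
have -> : tensor_pi [:: (m, n)] = \sum_j pure_tensor m (c j *: (y j : N)).
  by rewrite -pure_tensor_sumr; congr pure_tensor.
rewrite -big_split /=; apply: eq_bigr => j _.
by rewrite wE pure_tensorDl pure_tensorZ.
Qed.

Lemma tensor_factor_sub (J K : finType) (y : J -> S) (z : K -> S) (C : J -> K -> A) s w :
  (forall j, y j = \sum_k phi (C j k) * z k) -> tensor_factor y s w ->
  tensor_factor z s (fun k => \sum_j C j k *: w j).
Proof.
move=> yC; elim: s w => [|[m n] s IHs] w /=.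
  by move=> w0 k; rewrite big1 // => j _; rewrite w0 scaler0.
case=> c [w' [nE /IHs sE wE]]; exists (fun k => \sum_j c j * C j k).
exists (fun k => \sum_j C j k *: w' j); split=> // [|k].
  rewrite nE; under eq_bigr => j _ do rewrite yC mulr_sumr.
  rewrite exchange_big /=; apply: eq_bigr => k _; rewrite rmorph_sum mulr_suml.
  by apply: eq_bigr => j _; rewrite rmorphM mulrA.
rewrite scaler_suml -big_split /=; apply: eq_bigr => j _.
by rewrite wE scalerDr scalerA mulrC.
Qed.

Lemma tensor_factor_cat (J : finType) (y : J -> S) s t w w' :
  tensor_factor y s w -> tensor_factor y t w' ->
  tensor_factor y (s ++ t) (fun j => w j + w' j).
Proof.
elim: s w => [|[m n] s IHs] w /=.
  move=> w0 tw; have -> // : (fun j => w j + w' j) = w'.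
  by apply/funext => j; rewrite w0 add0r.
case=> c [v [nE sv wE]] tw; exists c, (fun j => v j + w' j); split=> // [|j].
  exact: IHs.
by rewrite wE addrA.
Qed.

Lemma tensor_factor_ext (J : finType) (y : J -> S) s w w' :
  w =1 w' -> tensor_factor y s w -> tensor_factor y s w'.
Proof. by move=> /funext->. Qed.

(** Each term of [t] has its second component expanded along both [y] and [y']; the difference of
    the two expansions is one relation in [rs]. *)
Lemma tensor_factor_relations (J J' : finType) (y : J -> S) (y' : J' -> S) t w w' :
  tensor_factor y t w -> tensor_factor y' t w' ->
  exists rs : seq (J + J' -> A),
    (forall r, List.In r rs ->
       \sum_i phi (r i) * (match i with inl j => y j | inr j => y' j end) = 0) /\
    (forall c : J + J' -> A, (forall r, List.In r rs -> \sum_i r i * c i = 0) ->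
       \sum_j c (inl j) *: w j = \sum_j c (inr j) *: w' j).
Proof.
elim: t w w' => [|[m n] t IHt] w w' /=.
  move=> w0 w'0; exists [::]; split=> // c _.
  by rewrite !big1 // => j _; rewrite ?w0 ?w'0 scaler0.
case=> c [v [nE tv wE]] [c' [v' [nE' tv' wE']]].
have [rs [rsP rsc]] := IHt _ _ tv tv'.
exists ((fun i => match i with inl j => c j | inr j => - c' j end) :: rs); split.
  move=> r [<-|]; last exact: rsP.
  rewrite big_sumType /= -nE; under [X in _ + X]eq_bigr => j _ do rewrite rmorphN mulNr.
  by rewrite sumrN -nE' subrr.
move=> d dP; have := rsc d (fun r rrs => dP r (or_intror rrs)).
have := dP _ (or_introl erefl); rewrite big_sumType /=.
under [X in _ + X]eq_bigr => j _ do rewrite mulNr.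
rewrite sumrN => /eqP; rewrite subr_eq0 => /eqP cd dv.
under eq_bigr => j _ do rewrite wE scalerDr scalerA mulrC.
under [in RHS]eq_bigr => j _ do rewrite wE' scalerDr scalerA mulrC.
rewrite !big_split /= -!scaler_suml dv; congr (_ *: _ + _).
exact: cd.
Qed.

Hypothesis flat_phi : flat_on setT phi.

(** Flatness solves all the relations between two expansions of [t] at once, which yields a common
    refinement. *)
Lemma tensor_factor_merge (J J' : finType) (y : J -> S) (y' : J' -> S) t w w' :
  tensor_factor y t w -> tensor_factor y' t w' ->
  exists (K : finType) (z : K -> S) (C : J -> K -> A) (C' : J' -> K -> A),
    [/\ forall j, y j = \sum_k phi (C j k) * z k,
        forall j, y' j = \sum_k phi (C' j k) * z k
      & forall k, \sum_j C j k *: w j = \sum_j C' j k *: w' j].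
Proof.
move=> tw tw'; have [rs [rsP rsc]] := tensor_factor_relations tw tw'.
have [|||||K [C [z [_ yC rC]]]] := flat_on_system _ _ _ _ flat_phi
  (x := fun i : J + J' => match i with inl j => y j | inr j => y' j end) (rs := rs) => //.
  by move=> r /rsP.
exists K, z, (fun j => C (inl j)), (fun j => C (inr j)); split=> [j|j|k].
- exact: (yC (inl j)).
- exact: (yC (inr j)).
- by apply: (rsc (C ^~ k)) => r /rC.
Qed.

Definition tensor_cofactor (s t : seq (M * N)) : Prop :=
  exists (J : finType) (y : J -> S) (w : J -> M),
    tensor_factor y s w /\ tensor_factor y t w.

(** Every formal sum expands along its own second components, with one new index per term. *)
Lemma tensor_cofactor_refl s : tensor_cofactor s s.
Proof.
suff [J [y [w sw]]] : exists (J : finType) (y : J -> S) (w : J -> M), tensor_factor y s w.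
  by exists J, y, w.
elim: s => [|[m n] s [J [y [w sw]]]]; first by exists void, (fun=> 0), (fun=> 0).
exists (option J), (fun j => if j is Some j' then y j' else n).
exists (fun j => if j is Some j' then w j' else m); exists (fun j => (j == None)%:R).
exists (fun j => if j is Some j' then w j' else 0); split=> [||[j|]].
- rewrite (bigD1 None) //= rmorph1 mul1r big1 ?addr0 // => j /negPf->.
  by rewrite rmorph0 mul0r.
- apply: (tensor_factor_ext _ (tensor_factor_sub
    (C := fun j (k : option J) => (k == Some j)%:R) _ sw)) => [[k|]|j].
  + rewrite (bigD1 k) //= eqxx scale1r big1 ?addr0 // => j jk.
    by case: eqP => [[kj]|_]; [rewrite kj eqxx in jk | rewrite scale0r].
  + by rewrite big1 // => j _; rewrite scale0r.
  + rewrite (bigD1 (Some j)) //= eqxx rmorph1 mul1r big1 ?addr0 // => k /negPf->.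
    by rewrite rmorph0 mul0r.
- by rewrite scale0r add0r.
- by rewrite scale1r addr0.
Qed.

Lemma tensor_factor_inl (J J' : finType) (y : J -> S) (y' : J' -> S) s w :
  tensor_factor y s w ->
  tensor_factor (fun i : J + J' => match i with inl j => y j | inr j => y' j end) s
    (fun i => match i with inl j => w j | inr _ => 0 end).
Proof.
move=> sw; apply: (tensor_factor_ext _ (tensor_factor_sub
    (C := fun j (k : J + J') => (k == inl j)%:R) _ sw)) => [[k|k]|j].
- rewrite (bigD1 k) //= eqxx scale1r big1 ?addr0 // => j jk.
  by case: eqP => [[kj]|_]; [rewrite kj eqxx in jk | rewrite scale0r].
- by rewrite big1 // => j _; rewrite scale0r.
- rewrite (bigD1 (inl j)) //= eqxx rmorph1 mul1r big1 ?addr0 // => k /negPf->.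
  by rewrite rmorph0 mul0r.
Qed.

Lemma tensor_factor_inr (J J' : finType) (y : J -> S) (y' : J' -> S) s w :
  tensor_factor y' s w ->
  tensor_factor (fun i : J + J' => match i with inl j => y j | inr j => y' j end) s
    (fun i => match i with inl _ => 0 | inr j => w j end).
Proof.
move=> sw; apply: (tensor_factor_ext _ (tensor_factor_sub
    (C := fun j (k : J + J') => (k == inr j)%:R) _ sw)) => [[k|k]|j].
- by rewrite big1 // => j _; rewrite scale0r.
- rewrite (bigD1 k) //= eqxx scale1r big1 ?addr0 // => j jk.
  by case: eqP => [[kj]|_]; [rewrite kj eqxx in jk | rewrite scale0r].
- rewrite (bigD1 (inr j)) //= eqxx rmorph1 mul1r big1 ?addr0 // => k /negPf->.
  by rewrite rmorph0 mul0r.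
Qed.

Lemma tensor_cofactor_trans s t u :
  tensor_cofactor s t -> tensor_cofactor t u -> tensor_cofactor s u.
Proof.
move=> [J [y [w [sw tw]]]] [J' [y' [w' [tw' uw']]]].
have [K [z [C [C' [yC yC' CC']]]]] := tensor_factor_merge tw tw'.
exists K, z, (fun k => \sum_j C j k *: w j); split; first exact: tensor_factor_sub sw.
by apply: tensor_factor_ext (tensor_factor_sub yC' uw') => k.
Qed.

Lemma tensor_cofactor_cat s s' t t' : tensor_cofactor s s' -> tensor_cofactor t t' ->
  tensor_cofactor (s ++ t) (s' ++ t').
Proof.
move=> [J [y [w [sw sw']]]] [J' [y' [w' [tw tw']]]]; exists (J + J')%type.
do 2!eexists; split; apply: tensor_factor_cat.
- exact: (tensor_factor_inl y' sw).
- exact: (tensor_factor_inr y tw).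
- exact: (tensor_factor_inl y' sw').
- exact: (tensor_factor_inr y tw').
Qed.

Lemma tensor_cofactor1 (n : N) (s : seq (M * N)) m :
  tensor_factor (fun _ : unit => n) s (fun=> m) -> tensor_cofactor [:: (m, n)] s.
Proof.
move=> sm; exists unit, (fun=> n), (fun=> m); split=> //=.
exists (fun=> 1), (fun=> 0); split=> // [|j]; last by rewrite scale1r addr0.
by rewrite (big_pred1 tt) ?rmorph1 ?mul1r // => -[].
Qed.

(** Having a common expansion is a congruence that contains the bilinear relations, hence contains
    the congruence they generate. Flatness enters through transitivity. *)
Lemma tensor_eq_cofactor s t : tensor_eq s t -> tensor_cofactor s t.
Proof.
have sum1 (F : unit -> S) : \sum_j F j = F tt by apply: big_pred1 => -[].
elim=> {s t} [s|s t _|s t u _ st _|s s' t t' _ ss' _ tt'|s t|n|m m' n|m n n'|a m n].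
- exact: tensor_cofactor_refl.
- by move=> [J [y [w [sw tw]]]]; exists J, y, w.
- exact: tensor_cofactor_trans.
- exact: tensor_cofactor_cat.
- have [J [y [w [sw _]]]] := tensor_cofactor_refl s.
  have [J' [y' [w' [tw' _]]]] := tensor_cofactor_refl t.
  do 3!eexists; split.
    apply: tensor_factor_cat; first exact: (tensor_factor_inl y' sw).
    exact: (tensor_factor_inr y tw').
  apply: tensor_factor_ext; last first.
    apply: tensor_factor_cat; first exact: (tensor_factor_inr y tw').
    exact: (tensor_factor_inl y' sw).
  by move=> j /=; rewrite addrC.
- exact: tensor_cofactor1.
- apply: tensor_cofactor1; exists (fun=> 1), (fun=> m'); split=> [||j].
  + by rewrite sum1 rmorph1 mul1r.
  + exists (fun=> 1), (fun=> 0); split=> // [|j]; rewrite ?scale1r ?addr0 //.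
    by rewrite sum1 rmorph1 mul1r.
  + by rewrite scale1r.
- exists bool, (fun b : bool => if b then n else n'), (fun=> m); split=> /=.
    exists (fun=> 1), (fun=> 0); split=> // [|j]; last by rewrite scale1r addr0.
    by rewrite big_bool /= rmorph1 !mul1r.
  exists (fun b => b%:R), (fun b => (~~ b)%:R *: m); split=> [||[]].
  + by rewrite big_bool /= rmorph1 rmorph0 mul0r mul1r addr0.
  + exists (fun b => (~~ b)%:R), (fun=> 0); split=> // [|j].
      by rewrite big_bool /= rmorph1 rmorph0 mul0r mul1r add0r.
    by rewrite addr0.
  + by rewrite scale1r scale0r addr0.
  + by rewrite scale1r scale0r add0r.
- apply: tensor_cofactor1; exists (fun=> a), (fun=> 0); split=> [||j].
  + by rewrite sum1.
  + by [].
  + by rewrite addr0.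
Qed.

(** A common expansion with the empty sum gives 1 as a combination of [y] whose coefficients all
    kill [m]; these coefficients generate the unit ideal. *)
Lemma pure_tensor1_eq0 (m : M) : reflects_unimodular phi ->
  pure_tensor m (1 : N) = 0 -> m = 0.
Proof.
move=> uni /tensor_piP /tensor_eq_cofactor[J [y [w [/= mw w0]]]].
have [c [w' [/esym /uni[d cd] w'0 wE]]] := mw.
rewrite -[m]scale1r -cd scaler_suml big1 // => j _.
by rewrite mulrC -scalerA -[_ *: m]addr0 -(w'0 j) -wE w0 scaler0.
Qed.

End Factor.

Lemma tensor_factor_map (M M' : lmodType A) (u : {linear M -> M'}) (J : finType)
    (y : J -> S) s w :
  tensor_factor y s w -> tensor_factor y (tensor_map_seq u s : seq (M' * N)) (u \o w).
Proof.
elim: s w => [|[m n] s IHs] w /=; first by move=> w0 j; rewrite w0 linear0.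
case=> c [w' [nE /IHs sw wE]]; exists c, (u \o w'); split=> // j /=.
by rewrite wE linearP.
Qed.

(** Common expansions turn exactness after tensoring into exactness on coefficients; the converse
    tests the tensored sequence on tensors with second component 1. *)
Lemma flat_faithfully_flat :
  flat_on setT phi -> reflects_unimodular phi -> faithfully_flat phi.
Proof.
move=> flat uni N1 N2 N3 u v; split=> uv.
- move=> x; split=> [|[x' <-]].
    rewrite -(tensor_piK x) tensor_mapE; set s := repr x.
    move/(tensor_piP _ [::]).
    have [J [y [w [sw _]]]] := tensor_cofactor_refl s.
    move/(tensor_eq_cofactor flat)=> [J' [y' [w' [sw' /= w'0]]]].
    have [K [z [C [C' [yC yC' CC']]]]] := tensor_factor_merge flat (tensor_factor_map v sw) sw'.
    have sC := tensor_factor_sub yC sw.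
    (* After refinement along [z], every single coefficient of [s] is killed by [v], so each one
       lifts through [u]. *)
    have /choice[g gE] : forall k, exists m, u m = \sum_j C j k *: w j.
      move=> k; apply/uv; rewrite linear_sum; under eq_bigr => j _ do rewrite linearZ.
      by have /= -> := CC' k; rewrite big1 // => j _; rewrite w'0 scaler0.
    exists (\sum_k pure_tensor (g k) (z k : N)); rewrite linear_sum (tensor_factor_pi sC).
    by apply: eq_bigr => k _; rewrite -gE; apply: tensor_map_pure.
  rewrite -(tensor_piK x') !tensor_mapE tensor_pi_sum !big_map big1 // => p _ /=.
  have -> : v (u p.1) = 0 by apply/uv; exists p.1.
  exact: pure_tensor0l.
- have vu x : v (u x) = 0.
    apply: (pure_tensor1_eq0 flat uni); rewrite -!tensor_map_pure.
    by apply/uv; eexists.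
  move=> y; split=> [vy|[x <-]]; last exact: vu.
  have [X] : exists X, tensor_map N u X = pure_tensor y (1 : N).
    by apply/uv; rewrite tensor_map_pure vy pure_tensor0l.
  rewrite -(tensor_piK X) tensor_mapE; set s := repr X => /tensor_piP.
  move/(tensor_eq_cofactor flat)=> [J [z [w [sw yw]]]].
  have [J' [z' [w' [sw' _]]]] := tensor_cofactor_refl s.
  have [K [x [C [C' [zC z'C CC']]]]] := tensor_factor_merge flat sw (tensor_factor_map u sw').
  (* Along [x], the tensor of [y] with 1 has the coefficients [c k *: y], all in the image of [u];
     since the [c k] generate the unit ideal, [y] lies in the image too. *)
  have [c [w'' [/esym /uni[d cd] w''0 wE]]] := tensor_factor_sub zC yw.
  exists (\sum_k d k *: \sum_j C' j k *: w' j); rewrite linear_sum.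
  rewrite -[y]scale1r -cd scaler_suml; apply: eq_bigr => k _; rewrite mulrC -scalerA.
  have -> : c k *: y = \sum_j C' j k *: u (w' j) by rewrite -CC' wE w''0 addr0.
  rewrite linearZ linear_sum /=.
  by congr (_ *: _); apply: eq_bigr => j _; rewrite linearZ.
Qed.

(** For injectivity, [phi x = 0] is a relation on the element 1 of [S]; solving it gives a
    unimodular family annihilated by [x]. *)
Lemma flat_ff_embedding :
  flat_on setT phi -> reflects_unimodular phi -> ff_embedding phi.
Proof.
move=> flat uni; split; last exact: flat_faithfully_flat.
apply: raddf_inj => x x0.
have [||J [W [y [_ yE aW]]]] := flat unit (fun=> x) (fun=> 1) => //.
  by rewrite big1 // => i _; rewrite x0 mul0r.
have [d Wd] := uni _ _ _ (esym (yE tt)).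
rewrite -[x]mulr1 -Wd mulr_sumr big1 // => j _.
by rewrite mulrA; have := aW j; rewrite (big_pred1 tt) => [->|[]//]; rewrite mul0r.
Qed.

End TensorFlat.

(** * Consequences of faithful flatness: solving relations and contracting ideals *)

Section Relations.
Variables (A : comPzRingType) (I : finType) (a : I -> A).

Definition relation_pred : {pred {ffun I -> A^o}} :=
  fun f => \sum_i a i * (f i : A) == 0.

Lemma relation_submod_closed : submod_closed relation_pred.
Proof.
split=> [|c f g /eqP f0 /eqP g0]; apply/eqP.
  by rewrite big1 // => i _; rewrite ffunE mulr0.
transitivity (c * (\sum_i a i * (f i : A)) + \sum_i a i * (g i : A)).
  rewrite mulr_sumr -big_split /=.
  by apply: eq_bigr => i _; rewrite !ffunE mulrDr mulrCA.
by rewrite f0 g0 mulr0 addr0.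
Qed.

HB.instance Definition _ :=
  GRing.isSubmodClosed.Build A {ffun I -> A^o} relation_pred relation_submod_closed.

(** The syzygies of [a], made a module so that faithful flatness applies to the exact sequence they
    form with the dot product. *)
Definition relations : Type := {f : {ffun I -> A^o} | relation_pred f}.
HB.instance Definition _ := SubType.on relations.
HB.instance Definition _ := [Choice of relations by <:].
HB.instance Definition _ := [SubChoice_isSubLmodule of relations by <:].

Definition relation_val (f : relations) : {ffun I -> A^o} := val f.
Lemma relation_val_linear : linear relation_val.
Proof. by move=> c f g. Qed.
HB.instance Definition _ :=
  GRing.isLinear.Build A relations {ffun I -> A^o} _ relation_val relation_val_linear.

Definition dot_product (f : {ffun I -> A^o}) : A^o := \sum_i a i * (f i : A).
Lemma dot_product_linear : linear dot_product.
Proof.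
move=> c f g; rewrite /dot_product scaler_sumr -big_split /=.
by apply: eq_bigr => i _; rewrite !ffunE mulrDr [c *: f i]/(c * f i) mulrCA.
Qed.
HB.instance Definition _ :=
  GRing.isLinear.Build A {ffun I -> A^o} A^o _ dot_product dot_product_linear.

Lemma relations_exact : exact_seq 0 relation_val dot_product.
Proof.
move=> f; split=> [f0|[[g g0] <-]]; last exact/eqP.
have Pf : relation_pred f by apply/eqP.
by exists (Sub f Pf).
Qed.

End Relations.

Section FaithfullyFlat.
Variables (A S : comPzRingType) (phi : {rmorphism A -> S}).
Hypothesis ff : faithfully_flat phi.
Local Notation N := (restrict_scalars phi).

(** The tensor with coordinates [x i] is killed by the dot product with [a], so it comes from a sum
    of syzygies tensored with elements of [S]. The syzygies are the columns of [W], the elements of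
    [S] are [y]. *)
Lemma faithfully_flat_flat_on : flat_on setT phi.
Proof.
move=> I a x _ ax0.
pose e (i : I) : {ffun I -> A^o} := [ffun i' => ((i' == i)%:R : A^o)].
pose X : seq ({ffun I -> A^o} * N) := [seq (e i, x i : N) | i <- index_enum I].
(* The coordinate at [i] of a tensor is well defined in [S]. *)
have ev (i : I) (s t : seq ({ffun I -> A^o} * N)) : tensor_eq s t ->
    \sum_(p <- s) phi (p.1 i) * (p.2 : S) = \sum_(p <- t) phi (p.1 i) * (p.2 : S).
  elim=> {s t} [//|//|s t u _ -> _ ->//|s s' t t' _ ss' _ tt'|s t|n|m m' n|m n n'|b m n].
  - by rewrite !big_cat /= ss' tt'.
  - by rewrite !big_cat /= addrC.
  - by rewrite big_seq1 big_nil /= ffunE rmorph0 mul0r.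
  - by rewrite !big_cons !big_nil /= ffunE rmorphD !addr0 mulrDl.
  - by rewrite !big_cons !big_nil /= !addr0 mulrDr.
  - by rewrite !big_cons !big_nil /= !addr0 ffunE rmorphM mulrCA mulrA.
have [Y YX] : exists Y, tensor_map N (@relation_val A I a) Y = tensor_pi X.
  apply/(ff (@relation_val A I a) (dot_product a)).1; first exact: relations_exact.
  rewrite tensor_mapE tensor_pi_sum /tensor_map_seq /X -map_comp big_map /=.
  under eq_bigr => i _.
    have -> : dot_product a (e i) = a i *: (1 : A^o).
      rewrite /dot_product (bigD1 i) //= big1 ?addr0 => [|j /negPf ji].
        by rewrite ffunE eqxx.
      by rewrite ffunE ji mulr0.
    rewrite pure_tensorZ.
  over.
  rewrite -pure_tensor_sumr; apply: etrans (pure_tensor0r _ _).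
  by congr pure_tensor.
move: YX; rewrite -(tensor_piK Y) tensor_mapE; set s := repr Y => /tensor_piP sX.
exists 'I_(size s), (fun i l => relation_val (tnth (in_tuple s) l).1 i).
exists (fun l => (tnth (in_tuple s) l).2); split=> // [i|l].
  transitivity (\sum_(p <- X) phi (p.1 i) * (p.2 : S)).
    rewrite big_map (bigD1 i) //= big1 => [|j].
      by rewrite ffunE eqxx rmorph1 mul1r addr0.
    by rewrite eq_sym ffunE => /negPf->; rewrite rmorph0 mul0r.
  by rewrite -(ev i _ _ sX) big_map [LHS](big_tnth _ _ s).
by apply/eqP; exact: (valP (tnth (in_tuple s) l).1).
Qed.

(** The contraction of the extended ideal IS is I. Multiplication by [x] from A to A/I vanishes
    after tensoring with S, because [phi x] lies in IS. Exactness of this map followed by the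
    identity says that it is zero, and this descends to A. *)
Lemma faithfully_flat_contraction (I : ideal A) (J : finType) (c : J -> A)
    (z : J -> S) (x : A) :
  (forall j, I (c j)) -> phi x = \sum_j phi (c j) * z j -> I x.
Proof.
move=> Ic xE; pose Q : lmodType A := restrict_scalars (quot_pi I).
pose u (a : A^o) : Q := quot_pi I (a * x).
have ulin : linear u.
  move=> b a a'; rewrite -[LHS]/(quot_pi I ((b * (a : A) + a') * x)).
  by rewrite mulrDl -mulrA rmorphD rmorphM.
pose U : {linear A^o -> Q} := HB.pack u (GRing.isLinear.Build A A^o Q _ u ulin).
have id0 X : tensor_map N (idfun : {linear Q -> Q}) X = X.
  by rewrite -(tensor_piK X) tensor_mapE; congr tensor_pi; elim: (repr X) => //= -[? ?] ? ->.
have [_ exU] := ff U (idfun : {linear Q -> Q}).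
have U0 : exact_seq 0 U (idfun : {linear Q -> Q}).
  apply: exU => Y; rewrite id0; split=> [->|[X <-]]; first by exists 0; rewrite linear0.
  rewrite -(tensor_piK X) tensor_mapE tensor_pi_sum big_map big1 // => -[b n] _ /=.
  have -> : pure_tensor (U b) n = pure_tensor (quot_pi I b : Q) (x *: n).
    by rewrite -pure_tensorZ; congr pure_tensor; rewrite /U /= /u mulrC rmorphM.
  have -> : x *: n = \sum_j c j *: ((z j * (n : S)) : N).
    rewrite restrict_scaleE xE mulr_suml; apply: eq_bigr => j _.
    by rewrite restrict_scaleE mulrA.
  rewrite pure_tensor_sumr big1 // => j _; rewrite -pure_tensorZ.
  have -> : c j *: (quot_pi I b : Q) = 0; last exact: pure_tensor0l.
  have Icj : quot_pi I (c j) = 0.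
    by rewrite -(rmorph0 (quot_pi I)); apply/quot_piP; rewrite subr0.
  by rewrite -[LHS]/(quot_pi I (c j) * quot_pi I b) Icj mul0r.
have : U 1 = 0 by apply/U0; exists 1.
rewrite /U /= /u mul1r -(rmorph0 (quot_pi I)) => /quot_piP.
by rewrite subr0.
Qed.
End FaithfullyFlat.

(** * Local rings *)

Section LocalRings.
Variable R : comPzRingType.
Implicit Types (I J m n : ideal R) (x : R).

Lemma ideal0 I : I 0. Proof. by case: (idealP I). Qed.
Lemma idealD I x y : I x -> I y -> I (x + y). Proof. by case: (idealP I) => _ + _; apply. Qed.
Lemma idealMl I a x : I x -> I (a * x). Proof. by case: (idealP I) => _ _; apply. Qed.
Lemma idealMr I a x : I x -> I (x * a). Proof. by rewrite mulrC; apply: idealMl. Qed.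
Lemma idealN I x : I x -> I (- x). Proof. by rewrite -mulN1r; apply: idealMl. Qed.
Lemma idealB I x y : I x -> I y -> I (x - y).
Proof. by move=> Ix /idealN; apply: idealD. Qed.
Lemma ideal_sum I (J : Type) (r : seq J) (F : J -> R) :
  (forall j, I (F j)) -> I (\sum_(j <- r) F j).
Proof. by move=> IF; apply: big_ind => // [|x y]; [apply: ideal0|apply: idealD]. Qed.

Lemma ideal1 I : I 1 -> forall x, I x.
Proof. by move=> I1 x; rewrite -[x]mulr1; apply: idealMl. Qed.

Lemma maximal_nonunit m x : maximal m -> m x -> ~ is_unit x.
Proof.
move=> [mT _] mx [y xy]; apply: mT; apply/seteqP; split=> // z _.
by apply: ideal1; rewrite -xy; apply: idealMr.
Qed.

Lemma nonunit_maximal x : ~ is_unit x -> exists2 m, maximal m & m x.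
Proof.
move=> xN.
pose P (X : set R) := X = set0 \/ [/\ is_ideal X, X x & ~ X 1].
have Px : P (fun y => exists a, y = a * x).
  right; split; [split|by exists 1; rewrite mul1r|].
  - by exists 0; rewrite mul0r.
  - by move=> _ _ [a ->] [b ->]; exists (a + b); rewrite mulrDl.
  - by move=> c _ [a ->]; exists (c * a); rewrite mulrA.
  - by case=> a ax; apply: xN; exists a; rewrite mulrC.
have [F FP Ftot|M [PM Mmax]] := @Zorn_bigcup R P.
  have [[X0 FX0 [y0 X0y]]|F0] := pselect (exists2 X, F X & X !=set0); last first.
    by left; apply/seteqP; split=> // y [X FX Xy]; case: F0; exists X => //; exists y.
  have FI X y : F X -> X y -> [/\ is_ideal X, X x & ~ X 1].
    by move=> FX Xy; have [X_0|//] := FP X FX; rewrite X_0 in Xy.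
  right; split; [split|by exists X0 => //; case: (FI X0 y0)|].
  - by exists X0 => //; case: (FI X0 y0) => // -[].
  - move=> y z [Y FY Yy] [Z FZ Zz].
    have [[_ YD _] _ _] := FI Y y FY Yy; have [[_ ZD _] _ _] := FI Z z FZ Zz.
    have [YZ|ZY] := Ftot _ _ FY FZ; first by exists Z => //; apply: ZD => //; apply: YZ.
    by exists Y => //; apply: YD => //; apply: ZY.
  - by move=> a y [Y FY Yy]; exists Y => //; have [[_ _ YM] _ _] := FI Y y FY Yy; apply: YM.
  - by case=> X FX X1; have [] := FI X 1 FX X1.
case: PM => [M0|[Mid Mx M1]].
  case: (Mmax _ _ Px); rewrite M0; split=> [|/(_ x)]; first exact: sub0set.
  by move=> x0; apply: x0; exists 1; rewrite mul1r.
exists (Ideal Mid) => //; split=> /= [MT|J MJ]; first by apply: M1; rewrite MT.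
have [J1|J1] := pselect (J 1); first by right; apply/seteqP; split=> // y _; apply: ideal1.
left; apply: contrapT => JM; apply: (Mmax J).
  by split=> // JsM; apply: JM; apply/seteqP.
by right; split=> //; [apply: idealP|apply: MJ].
Qed.

Lemma local_nonunitP m x : local_ring m -> m x <-> ~ is_unit x.
Proof.
move=> [mmax muniq]; split; first exact: maximal_nonunit.
by move=> /nonunit_maximal[n nmax nx]; rewrite -(muniq n nmax).
Qed.

Lemma local_unitP m x : local_ring m -> is_unit x <-> ~ m x.
Proof. by move=> mloc; rewrite (local_nonunitP _ mloc) notE. Qed.

Lemma local_ring_nonunits m : (forall x, m x <-> ~ is_unit x) -> ~ m 1 -> local_ring m.
Proof.
move=> mP m1.
have mI J : (exists x, J x /\ ~ m x) -> J 1.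
  by move=> [x [Jx /mP]]; rewrite notE => -[y <-]; apply: idealMr.
have mmax : maximal m.
  split=> [mT|J mJ]; first by apply: m1; rewrite mT.
  have [/mI J1|Jm] := pselect (exists x, J x /\ ~ m x).
    by right; apply/seteqP; split=> // x _; apply: ideal1.
  by left; apply/seteqP; split=> // x Jx; apply: contrapT => mx; apply: Jm; exists x.
split=> // n [nT nmax].
have nm : n `<=` m.
  move=> x nx; apply: contrapT => mx; apply: nT; apply/seteqP; split=> // y _.
  by apply: ideal1; apply: mI; exists x.
by have [->//|mT] := nmax _ nm; case: m1; rewrite mT.
Qed.

Lemma local_sub m x y : local_ring m -> m (x - y) -> is_unit x -> is_unit y.
Proof.
move=> mloc mxy /(local_unitP _ mloc) mx; apply/(local_unitP _ mloc) => my.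
by apply: mx; rewrite -(subrK y x); apply: idealD.
Qed.
End LocalRings.

Lemma rmorph_is_unit (R S : comPzRingType) (phi : {rmorphism R -> S}) x :
  is_unit x -> is_unit (phi x).
Proof. by move=> [y xy]; exists (phi y); rewrite -rmorphM xy rmorph1. Qed.

(** Some [c j] is a unit: otherwise the combination 1 would lie in [mS]. *)
Lemma local_reflects_unimodular (R S : comPzRingType) (mR : ideal R) (mS : ideal S)
    (phi : {rmorphism R -> S}) :
  local_ring mR -> ~ mS 1 -> local_hom mR mS phi -> reflects_unimodular phi.
Proof.
move=> locR mS1 locphi J c z cz.
have [[j /(local_unitP _ locR)[d cd]]|cm] := pselect (exists j, ~ mR (c j)).
  exists (fun k => if k == j then d else 0).
  rewrite (bigD1 j) //= eqxx cd big1 ?addr0 // => k /negPf->.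
  by rewrite mulr0.
case: mS1; rewrite -cz; apply: ideal_sum => j; apply/idealMr/locphi.
by apply: contrapT => cj; apply: cm; exists j.
Qed.

(** * A weak Artin-Rees lemma *)

Section ArtinRees.
Variable R : comPzRingType.
Implicit Types (I J N P Q m : ideal R) (x y n p u : R) (xs cs : seq R).

Lemma ideal_gen_sub (X : set R) I : X `<=` I -> ideal_gen X `<=` I.
Proof. by move=> XI x; apply. Qed.

Lemma ideal_gen_self (X : set R) : X `<=` ideal_gen X.
Proof. by move=> x Xx J; apply. Qed.

Lemma ideal_pow0 I x : ideal_pow I 0 x.
Proof. exact: ideal_gen_self. Qed.

Lemma ideal_powS_mul I k x y : I x -> ideal_pow I k y -> ideal_pow I k.+1 (x * y).
Proof. by move=> Ix Iy; apply: ideal_gen_self; exists x, y. Qed.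

Lemma ideal_powS_sub I J k :
  (forall x y, I x -> ideal_pow I k y -> J (x * y)) -> ideal_pow I k.+1 `<=` J.
Proof. by move=> IJ; apply: ideal_gen_sub => _ [x [y [Ix Iy ->]]]; apply: IJ. Qed.

Lemma ideal_pow_le I k l : (k <= l)%N -> ideal_pow I l `<=` ideal_pow I k.
Proof.
elim: l => [|l IHl]; first by rewrite leqn0 => /eqP->.
by rewrite leq_eqVlt => /predU1P[->//|/IHl lk] x /ideal_pow_sub/lk.
Qed.

Lemma ideal_pow_exp I k x : I x -> ideal_pow I k (x ^+ k).
Proof.
by move=> Ix; elim: k => [|k IHk]; [apply: ideal_pow0|rewrite exprS; apply: ideal_powS_mul].
Qed.

Definition span_with (D : set R) cs : set R :=
  [set n | exists2 d : nat -> R, (forall i, D (d i)) & n = \sum_(i < size cs) d i * cs`_i].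

Lemma span_with_is_ideal I cs : is_ideal (span_with I cs).
Proof.
split.
- by exists (fun=> 0) => [i|]; [apply: ideal0|rewrite big1 // => i _; rewrite mul0r].
- move=> _ _ [d Id ->] [e Ie ->]; exists (fun i => d i + e i) => [i|].
    exact: idealD.
  by rewrite -big_split; apply: eq_bigr => i _; rewrite mulrDl.
- move=> a _ [d Id ->]; exists (fun i => a * d i) => [i|]; first exact: idealMl.
  by rewrite mulr_sumr; apply: eq_bigr => i _; rewrite mulrA.
Qed.

Definition span_ideal I cs : ideal R := Ideal (span_with_is_ideal I cs).

Lemma ideal_gen_span I cs :
  (forall x, I x) -> ideal_gen [set x | x \in cs] `<=` span_ideal I cs.
Proof.
move=> IT; apply: ideal_gen_sub => x /= xcs.
exists (fun i => (i == index x cs)%:R) => // .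
have xi : (index x cs < size cs)%N by rewrite index_mem.
rewrite (bigD1 (Ordinal xi)) //= eqxx mul1r nth_index // big1 ?addr0 // => i.
by rewrite -val_eqE /= => /negPf->; rewrite mul0r.
Qed.

(** The sum of the sets x^k X over the x in [xs]. It stands in for powers of the ideal generated by
    [xs] and can be handled one generator at a time. *)
Fixpoint power_span k xs (X : set R) : set R :=
  if xs is x :: xs' then
    [set u | exists n r, [/\ X n, power_span k xs' X r & u = x ^+ k * n + r]]
  else [set 0].

Lemma power_spanS k xs (X Y : set R) :
  X `<=` Y -> power_span k xs X `<=` power_span k xs Y.
Proof.
move=> XY; elim: xs => //= x xs IHxs _ [n [r [/XY Yn /IHxs xr ->]]].
by exists n, r.
Qed.

Lemma power_span_is_ideal k xs N : is_ideal (power_span k xs N).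
Proof.
elim: xs => [|x xs [IH0 IHD IHM]] /=.
  by split=> // [_ _ -> ->|a _ ->]; [apply: addr0|apply: mulr0].
split.
- by exists 0, 0; split=> //; [apply: ideal0|rewrite mulr0 addr0].
- move=> _ _ [n [r [Nn xr ->]]] [n' [r' [Nn' xr' ->]]].
  exists (n + n'), (r + r'); split; [exact: idealD|exact: IHD|].
  by rewrite mulrDr addrACA.
- move=> a _ [n [r [Nn xr ->]]]; exists (a * n), (a * r).
  by split; [apply: idealMl|apply: IHM|rewrite mulrDr mulrCA].
Qed.

Definition power_ideal k xs N : ideal R := Ideal (power_span_is_ideal k xs N).

Lemma power_ideal_sub k xs N I :
  (forall x n, x \in xs -> N n -> I (x ^+ k * n)) -> power_ideal k xs N `<=` I.
Proof.
elim: xs => [_ _ ->|x xs IHxs xI] /=; first exact: ideal0.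
move=> _ [n [r [Nn xr ->]]]; apply: idealD; first by apply: xI; rewrite ?mem_head.
by apply: IHxs xr => y n' yxs; apply: xI; rewrite inE yxs orbT.
Qed.

Lemma mem_power_ideal k xs N x n : x \in xs -> N n -> power_ideal k xs N (x ^+ k * n).
Proof.
move=> + Nn; elim: xs => // y xs IHxs; rewrite inE => /predU1P[->|/IHxs xn].
  by exists n, 0; split; rewrite ?addr0 //; apply: (ideal0 (power_ideal k xs N)).
by exists 0, (x ^+ k * n); split; rewrite ?mulr0 ?add0r //; apply: ideal0.
Qed.

Lemma colon_is_ideal I x : is_ideal [set y | I (y * x)].
Proof.
split=> [|y z|a y] /=; first by rewrite mul0r; apply: ideal0.
  by rewrite mulrDl; apply: idealD.
by rewrite -mulrA; apply: idealMl.
Qed.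

Definition colon I x : ideal R := Ideal (colon_is_ideal I x).

(** Pigeonhole: a monomial of degree above the sum of the [k x] contains some x^(k x). The induction
    splits off one factor [z], replacing [Q] by the colon ideal of [Q] by [z] and lowering [k z] by
    one. *)
Lemma ideal_pow_sub_of_exp (k : R -> nat) (s : nat) xs I Q :
  I `<=` ideal_gen [set x | x \in xs] -> (forall x, x \in xs -> Q (x ^+ k x)) ->
  (\sum_(x <- xs) k x <= s)%N -> ideal_pow I s.+1 `<=` Q.
Proof.
move=> Ixs; elim: s k Q => [|s IHs] k Q Qk ks.
  apply: ideal_powS_sub => x y /Ixs xxs _; apply: idealMr; apply: xxs => z zxs.
  have := Qk z zxs; suff -> : k z = 0%N by move/ideal1.
  by move: ks; rewrite leqn0 sum_nat_seq_eq0 => /allP/(_ z zxs)/eqP.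
apply: ideal_powS_sub => x y /Ixs xxs Iy.
suff : colon Q y x by [].
apply: xxs => z zxs /=; have [kz0|kz] := posnP (k z).
  by apply: idealMr; apply: ideal1; have := Qk z zxs; rewrite kz0.
suff : colon Q z y by rewrite /= mulrC.
apply: (IHs (fun w => if w == z then (k z).-1 else k w)) Iy => [w wxs|].
  case: eqP => [->|_] /=; first by rewrite -exprSr prednK //; apply: Qk.
  exact/idealMr/Qk.
rewrite -ltnS; apply: leq_trans ks.
move: zxs; rewrite /=.
elim: xs {Ixs Qk IHs} => // w xs IHxs; rewrite inE !big_cons => /predU1P[<-|/IHxs zxs].
  rewrite eqxx -addSn prednK // leq_add2l; apply: leq_sum => v _.
  by case: eqP => [->|//]; apply: leq_pred.
rewrite -addnS; apply: leq_add => //.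
by case: eqP => [->|//]; apply: leq_pred.
Qed.

Hypothesis noethR : noetherian R.

Lemma noetherian_acc (C : nat -> ideal R) :
  (forall k, C k `<=` C k.+1) -> exists c, forall k, C k `<=` C c.
Proof.
move=> CS; have Cle k l : (k <= l)%N -> C k `<=` C l.
  elim: l => [|l IHl]; first by rewrite leqn0 => /eqP->.
  by rewrite leq_eqVlt => /predU1P[->//|/IHl kl] x /kl/CS.
have Uid : is_ideal [set x | exists k, C k x].
  split=> [|x y [k Ckx] [l Cly]|a x [k Ckx]]; first by exists 0%N; apply: ideal0.
    by exists (maxn k l); apply: idealD; [apply: Cle Ckx|apply: Cle Cly];
      rewrite ?leq_maxl ?leq_maxr.
  by exists k; apply: idealMl.
have [s Us] := noethR (Ideal Uid).
have [c sc] : exists c, forall x, x \in s -> C c x.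
  have : forall x, x \in s -> exists k, C k x.
    by move=> x xs; rewrite -[exists k, _]/(Ideal Uid x) Us; apply: ideal_gen_self.
  elim: s {Us} => [_|x s IHs sC]; first by exists 0%N.
  have [k Ckx] := sC x (mem_head _ _).
  have [|l sl] := IHs; first by move=> y ys; apply: sC; rewrite inE ys orbT.
  exists (maxn k l) => y; rewrite inE => /predU1P[->|/sl Cly].
    exact: Cle (leq_maxl _ _) _ Ckx.
  exact: Cle (leq_maxr _ _) _ Cly.
exists c => k x Ckx; have : Ideal Uid x by exists k.
by rewrite Us; apply.
Qed.

Definition sum_set (X Y : set R) : set R :=
  [set n | exists u p, [/\ X u, Y p & n = u + p]].

Lemma sum_is_ideal I J : is_ideal (sum_set I J).
Proof.
split.
- by exists 0, 0; split; rewrite ?addr0 //; apply: ideal0.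
- move=> _ _ [u [p [Iu Jp ->]]] [u' [p' [Iu' Jp' ->]]]; exists (u + u'), (p + p').
  by split; [apply: idealD|apply: idealD|rewrite addrACA].
- move=> a _ [u [p [Iu Jp ->]]]; exists (a * u), (a * p).
  by split; [apply: idealMl|apply: idealMl|rewrite mulrDr].
Qed.

Definition ideal_add I J : ideal R := Ideal (sum_is_ideal I J).

(** The colon ideals (N + P : x^k) stabilize at some c. If n = x^(c+l) f + p, then f multiplies
    x^(c+l), hence already x^c, into N + P, so n lies in x^l N + P. *)
Lemma principal_artin_rees x N P l : exists c, forall n, N n ->
  sum_set [set x ^+ c * f | f in setT] P n -> sum_set [set x ^+ l * f | f in N] P n.
Proof.
pose C k := colon (ideal_add N P) (x ^+ k).
have [c Cc] : exists c, forall k, C k `<=` C c.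
  by apply: noetherian_acc => k y Cy; rewrite /C /= exprS mulrCA;
    apply: (idealMl (I := ideal_add N P)).
exists (c + l)%N => n Nn [_ [p [[f _ <-] Pp nE]]].
have [n' [p' [Nn' Pp' ff]]] : C c f.
  apply: (Cc (c + l)%N); exists n, (- p); split=> //; first exact: idealN.
  by rewrite nE addrK mulrC.
exists (x ^+ l * n'), (x ^+ l * p' + p); split; first by exists n'.
  by apply: idealD => //; apply: idealMl.
by rewrite nE addrA -mulrDr -ff addnC exprD -mulrA [f * _]mulrC.
Qed.

(** Induction on the generators: the term of [x] is absorbed into P + x^c R, the induction
    hypothesis treats [xs], and the principal case treats the error, which lies both in N and in x^c
    R + P. *)
Lemma power_artin_rees xs N P l : exists k, forall k', (k <= k')%N -> forall n, N n ->
  sum_set (power_span k' xs setT) P n -> sum_set (power_span l xs N) P n.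
Proof.
elim: xs P => [|x xs IHxs] P; first by exists 0%N.
have [c xc] := principal_artin_rees x N P l.
have P'id : is_ideal (sum_set [set x ^+ c * f | f in setT] P).
  have -> : sum_set [set x ^+ c * f | f in setT] P =
      ideal_add (power_ideal c [:: x] (ideal_pow P 0)) P.
    apply/seteqP; split=> [_ [_ [p [[f _ <-] Pp ->]]]|_ [_ [p [[f [_ [_ -> ->]]] Pp ->]]]].
      exists (x ^+ c * f), p; split=> //; exists f, 0; split=> //; last by rewrite addr0.
      exact: ideal_pow0.
    by exists (x ^+ c * f + 0), p; split=> //; exists f; rewrite ?addr0.
  exact: sum_is_ideal.
have [k kP] := IHxs (Ideal P'id).
exists (maxn k c) => k'; rewrite geq_max => /andP[kk' ck'] n Nn.
move=> [_ [p [[f [r [_ xr ->]]] Pp nE]]].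
have [|u [_ [xu [_ [p' [[g _ <-] Pp' ->]]] nE']]] := kP k' kk' n Nn.
  exists r, (x ^+ c * (x ^+ (k' - c) * f) + p); split=> //.
    by exists (x ^+ c * (x ^+ (k' - c) * f)), p; split=> //; exists (x ^+ (k' - c) * f).
  by rewrite mulrA -exprD subnKC // nE addrAC addrA addrC addrA.
have Nu : N u by apply: (power_ideal_sub (k := l) _ xu) => y z _ Nz; apply: idealMl.
have [||_ [p'' [[h Nh <-] Pp'' uE]]] := xc (n - u).
- exact: idealB.
- exists (x ^+ c * g), p'; split; [by exists g | by [] |].
  by rewrite nE' addrC addKr.
exists (x ^+ l * h + u), p''; split=> //; first by exists h, u.
by rewrite addrAC -uE subrK.
Qed.

(** Only the two topologies are compared: [k] depends on [l] with no explicit bound. What matters is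
    that [k] is uniform in [n]. *)
Lemma weak_artin_rees I cs P l : exists k, forall k', (k <= k')%N -> forall n,
  span_with setT cs n -> sum_set (ideal_pow I k') P n ->
  sum_set (span_with (ideal_pow I l) cs) P n.
Proof.
have [xs Ixs] := noethR I.
have [k kP] := power_artin_rees xs (span_ideal (ideal_pow I 0) cs) P l.
(* In this degree every monomial in the generators contains a [k]-th power of one of them. *)
exists (size xs * k).+1 => k' kk' n [d _ nE] [u [p [Iu Pp nup]]].
have Iuk : power_ideal k xs (ideal_pow I 0) u.
  apply: (ideal_pow_sub_of_exp (I := I) (k := fun=> k) (xs := xs) (s := (size xs * k)%N)) => //.
  - by rewrite -Ixs.
  - move=> x xxs; rewrite -[x ^+ k]mulr1; apply: mem_power_ideal => //.
    exact: ideal_pow0.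
  - by rewrite big_const_seq count_predT iter_addn_0 mulnC.
  - exact: ideal_pow_le kk' _ Iu.
have [||v [q [xv Pq nvq]]] := kP k (leqnn k) n.
- by exists d => // i; apply: ideal_pow0.
- by exists u, p; split=> //; apply: power_spanS Iuk.
exists v, q; split=> //.
apply: (power_ideal_sub (I := span_ideal (ideal_pow I l) cs) _ xv) => x _ xxs [e _ ->].
exists (fun i => x ^+ l * e i) => [i|].
  by apply: idealMr; apply: ideal_pow_exp; rewrite Ixs; apply: ideal_gen_self.
by rewrite mulr_sumr; apply: eq_bigr => i _; rewrite mulrA.
Qed.
End ArtinRees.

(** * Flatness of the completion *)

Section CompletionFlat.
Variables (R : comPzRingType) (m : ideal R).
Hypothesis noethR : noetherian R.
Local Notation pi n := (quot_pi (ideal_pow m n)).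
Implicit Types (z : adic_completion m).

Lemma adic_val_sum (J : Type) (r : seq J) (F : J -> adic_completion m) n :
  (\sum_(j <- r) F j) n = \sum_(j <- r) F j n.
Proof. exact: (big_morph (fun z : adic_completion m => z n)). Qed.

Lemma adic_le z k l a : (k <= l)%N -> pi l a = z l -> pi k a = z k.
Proof.
elim: l => [|l IHl]; first by rewrite leqn0 => /eqP->.
rewrite leq_eqVlt => /predU1P[->//|/IHl kl zl].
exact/kl/adicP.
Qed.

Lemma quot_pi_eq (I : ideal R) x y : I (x - y) -> quot_pi I x = quot_pi I y.
Proof. by move=> /quot_piP. Qed.

Section Colon.
Variables (I : ideal R) (b : R) (J : finType) (c : J -> R).
Variables (z : adic_completion m) (x : J -> adic_completion m).
Hypothesis Ic : forall j, I (c j).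
Hypothesis bz : adic_of m b * z = \sum_j adic_of m (c j) * x j.

(** A representative [a] of [z] at a high level has a b in I + m^k'; weak Artin-Rees for (b) then
    corrects [a] by an element of m^n so that the product lies in I. *)
Lemma adic_colon_approx n : exists2 a, colon I b a & pi n a = z n.
Proof.
have [k kP] := weak_artin_rees noethR m [:: b] I n.
set k' := maxn k n; pose a := repr (z k').
have [||_ [p [[d md ->] Ip]]] := kP k' (leq_maxl _ _) (a * b).
- by exists (fun=> a) => //; rewrite big_ord1.
- pose s := \sum_j c j * repr (x j k').
  exists (a * b - s), s; rewrite subrK; split=> //; last first.
    by apply: ideal_sum => j; apply: idealMr.
  apply/quot_piP; have := congr1 (fun y : adic_completion m => y k') bz.
  rewrite adic_val_sum /= => bzk; rewrite mulrC rmorphM /= quot_piK bzk rmorph_sum.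
  by apply: eq_bigr => j _; rewrite rmorphM /= quot_piK.
rewrite big_ord1 /= => abE; exists (a - d 0%N).
  by rewrite /= mulrBl abE addrC addKr.
have <- : pi n a = z n by apply: (adic_le (leq_maxr k n)); apply: quot_piK.
by apply: quot_pi_eq; rewrite addrAC subrr sub0r; apply: idealN.
Qed.

(** Approximants of [z] in (I : b) are chosen so close that weak Artin-Rees writes their differences
    along generators [cs] with coefficients in m^l. The coefficients then sum to elements of the
    completion. *)
Lemma adic_colon : exists (cs : seq R) (y : nat -> adic_completion m),
  (forall i, I (cs`_i * b)) /\ z = \sum_(i < size cs) adic_of m cs`_i * y i.
Proof.
have [cs csE] := noethR (colon I b).
have cs_span w : colon I b w -> span_with setT cs w.
  rewrite csE => /(ideal_gen_span (ideal_pow0 m))[d _ wE]; by exists d.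
have /choice[k kP] : forall l, exists k, forall k', (k <= k')%N -> forall n,
    colon I b n -> ideal_pow m k' n -> span_with (ideal_pow m l) cs n.
  (* [power_ideal 0 [::] m] is the zero ideal. *)
  move=> l; have [k kP] := weak_artin_rees noethR m cs (power_ideal 0 [::] m) l.
  exists k => k' kk' n /cs_span In mn.
  have [|u [p [xu /= -> ->]]] := kP k' kk' n In; last by rewrite addr0.
  by exists n, 0; rewrite addr0.
(* The sum makes [K] monotone and at least both [k l] and [l]. *)
pose K l := (l + \sum_(i < l.+1) k i)%N.
have kK l : (k l <= K l)%N.
  by rewrite /K big_ord_recr /= addnA leq_addl.
have KS l : (K l <= K l.+1)%N.
  by rewrite /K [X in (_ <= _ + X)%N]big_ord_recr /= addSn; apply: leqW; rewrite leq_add2l leq_addr.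
have /choice[w wP] : forall l, exists w, colon I b w /\ pi (K l) w = z (K l).
  by move=> l; have [a] := adic_colon_approx (K l); exists a.
have /choice[D DP] : forall l, exists d : nat -> R, (forall i, ideal_pow m l (d i)) /\
    w l.+1 - w l = \sum_(i < size cs) d i * cs`_i.
  move=> l; suff [d dm dE] : span_with (ideal_pow m l) cs (w l.+1 - w l).
    by exists d.
  have [Iw wz] := wP l; have [Iw' wz'] := wP l.+1.
  apply: (kP l (K l) (kK l)); first exact: idealB.
  by apply/quot_piP; rewrite wz; apply: adic_le wz'.
have [e _ w0] := cs_span _ (wP 0%N).1.
pose s i n := e i + \sum_(l < n) D l i.
have sS i n : s i n.+1 = s i n + D n i by rewrite /s big_ord_recr /= addrA.
have scompat i : adic_compatible (fun n => pi n (s i n)).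
  apply: adic_compatibleW => n; exists (s i n.+1) => //.
  by apply: quot_pi_eq; rewrite sS addrC addKr; case: (DP n).
exists cs, (fun i => Adic (scompat i)); split=> [i|].
  have [ics|ics] := ltnP i (size cs); last by rewrite nth_default // mul0r; apply: ideal0.
  suff : colon I b cs`_i by [].
  by rewrite csE; apply: ideal_gen_self; apply: mem_nth.
apply: adic_ext => n; rewrite adic_val_sum /=.
have wE : w n = \sum_(i < size cs) cs`_i * s i n.
  elim: n => [|n IHn].
    by rewrite w0; apply: eq_bigr => i _; rewrite /s big_ord0 addr0 mulrC.
  rewrite -[LHS](subrK (w n)) (DP n).2 IHn -big_split; apply: eq_bigr => i _ /=.
  by rewrite sS [RHS]mulrDr [RHS]addrC [D n i * _]mulrC.
have <- : pi n (w n) = z n by apply: adic_le (wP n).2; apply: leq_addr.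
by rewrite wE rmorph_sum; apply: eq_bigr => i _; rewrite rmorphM.
Qed.

End Colon.

(** Induction on a list supporting [x]: relations with prescribed coefficients at [i0] are
    subtracted so that the remaining family is supported in [s]. *)
Lemma completion_flat : flat_on setT (adic_of m).
Proof.
move=> I a x _; suff flatI (s : seq I) : (forall i, i \notin s -> x i = 0) ->
    \sum_i adic_of m (a i) * x i = 0 ->
    exists (J : finType) (W : I -> J -> R) (y : J -> adic_completion m),
      [/\ forall i l, setT (W i l), forall i, x i = \sum_l adic_of m (W i l) * y l
        & forall l, \sum_i a i * W i l = 0].
  by apply: (flatI (enum I)) => i; rewrite mem_enum.
elim: s x => [|i0 s IHs] x xs ax0.
  exists void, (fun _ _ => 0), (fun=> 0); split=> // i.
  by rewrite big1 ?xs // => -[].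
(* (Is : a i0) generates (Is R^ : a i0), which contains x i0. *)
pose Is := span_ideal (ideal_pow m 0) [seq a i | i <- s].
have aIs i : i \in s -> Is (a i).
  by move=> si; apply: ideal_gen_span; [apply: ideal_pow0|apply: ideal_gen_self; apply: map_f].
have [cs [y [Iy xE]]] : exists (cs : seq R) (y : nat -> adic_completion m),
  (forall i, Is (cs`_i * a i0)) /\ x i0 = \sum_(i < size cs) adic_of m cs`_i * y i.
  (* If [i0] occurs again in [s], then [a i0] lies in [Is] and the colon ideal is generated by 1. *)
  have [i0s|i0s] := boolP (i0 \in s).
    exists [:: 1], (fun=> x i0); split; last by rewrite big_ord1 /= rmorph1 mul1r.
    by case=> [|[|n]] /=; rewrite ?mul1r ?mul0r; [apply: aIs|apply: (ideal0 Is)|apply: (ideal0 Is)].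
  apply: (@adic_colon Is (a i0) I (fun i => if i \in s then a i else 0) (x i0)
            (fun i => if i \in s then - x i else 0)).
    by move=> i; case: ifP => [/aIs//|_]; apply: (ideal0 Is).
  move: ax0; rewrite (bigD1 i0) //= => /eqP; rewrite addr_eq0 => /eqP->.
  rewrite [RHS](bigD1 i0) //= (negPf i0s) mulr0 add0r -sumrN.
  apply: eq_bigr => i ii0; case: ifP => si; first by rewrite mulrN.
  by rewrite xs ?mulr0 ?oppr0 // inE negb_or ii0 si.
have /choice[e eP] : forall l : nat, exists e : I -> R, (forall i, i \notin s -> e i = 0) /\
    cs`_l * a i0 + \sum_i a i * e i = 0.
  move=> l; have [d _ csE] := Iy l.
  (* An index may occur several times in [s], so the coefficients at all its positions are added
     up. *)
  exists (fun i => - \sum_(j < size s | tnth (in_tuple s) j == i) d j); split=> [i si|].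
    rewrite big1 ?oppr0 // => j /eqP ji; case/negP: si.
    by rewrite -ji; apply: mem_tnth.
  rewrite csE size_map; under [X in _ + X]eq_bigr => i _ do rewrite mulrN.
  rewrite sumrN; apply/eqP; rewrite subr_eq0; apply/eqP.
  under [RHS]eq_bigr => i _ do rewrite mulr_sumr.
  rewrite (exchange_big_dep xpredT) //=; apply: eq_bigr => j _.
  rewrite (big_pred1 (tnth (in_tuple s) j)) => [|i]; last by rewrite eq_sym.
  rewrite mulrC; congr (_ * _).
  by rewrite (tnth_nth i0) /= (nth_map i0).
pose W i l := (i == i0)%:R * cs`_l + e l i.
have aW l : \sum_i a i * W i l = 0.
  rewrite -[RHS](eP l).2 /W; under eq_bigr => i _ do rewrite mulrDr.
  rewrite big_split /=; congr (_ + _); rewrite (bigD1 i0) //= eqxx mul1r mulrC.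
  by rewrite big1 ?addr0 // => i /negPf->; rewrite mul0r mulr0.
have [||K [V [v [_ vE aV]]]] := IHs (fun i => x i - \sum_(l < size cs) adic_of m (W i l) * y l).
- move=> i si; rewrite /W; under eq_bigr => l _ do rewrite (eP l).1 // addr0.
  have [->|ii0] := eqVneq i i0.
    by rewrite xE; apply/eqP; rewrite subr_eq0; apply/eqP/eq_bigr => l _; rewrite mul1r.
  rewrite xs ?inE ?negb_or ?ii0 // sub0r big1 ?oppr0 // => l _.
  by rewrite mul0r rmorph0 mul0r.
- under eq_bigr => i _ do rewrite mulrBr.
  rewrite big_split /= ax0 add0r sumrN.
  under eq_bigr => i _ do rewrite mulr_sumr.
  rewrite exchange_big big1 ?oppr0 // => l _ /=.
  rewrite -[RHS](mul0r (y l)) -[X in X * _](rmorph0 (adic_of m)) -(aW l) rmorph_sum mulr_suml.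
  by apply: eq_bigr => i _; rewrite rmorphM mulrA.
exists ('I_(size cs) + K)%type.
exists (fun i (l : 'I_(size cs) + K) => match l with inl l => W i l | inr l => V i l end).
exists (fun l : 'I_(size cs) + K => match l with inl l => y l | inr l => v l end).
split=> // [i|[l|l]] //.
by rewrite big_sumType /= -vE addrC subrK.
Qed.
End CompletionFlat.

(** * Adjoining a simple root *)

Definition subring_set (R : comPzRingType) (T : set R) : Prop :=
  [/\ T 1, forall x y, T x -> T y -> T (x - y) & forall x y, T x -> T y -> T (x * y)].

Section SubringSet.
Variables (R : comPzRingType) (T : set R).
Hypothesis subT : subring_set T.

Lemma subring_set1 : T 1. Proof. by case: subT. Qed.
Lemma subring_setB x y : T x -> T y -> T (x - y). Proof. by case: subT => _ + _; apply. Qed.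
Lemma subring_setM x y : T x -> T y -> T (x * y). Proof. by case: subT => _ _; apply. Qed.
Lemma subring_set0 : T 0.
Proof. by rewrite -(subrr 1); apply: subring_setB; apply: subring_set1. Qed.
Lemma subring_setN x : T x -> T (- x).
Proof. by move=> Tx; rewrite -sub0r; apply: subring_setB => //; apply: subring_set0. Qed.
Lemma subring_setD x y : T x -> T y -> T (x + y).
Proof. by move=> Tx /subring_setN; rewrite -{2}[y]opprK; apply: subring_setB. Qed.
Lemma subring_set_sum (J : Type) (r : seq J) (P : pred J) (F : J -> R) :
  (forall j, P j -> T (F j)) -> T (\sum_(j <- r | P j) F j).
Proof. exact: (big_ind T subring_set0 subring_setD). Qed.
End SubringSet.

Lemma List_In_map (U : eqType) (V : Type) (f : U -> V) (s : seq U) v :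
  List.In v (map f s) <-> exists2 u, u \in s & v = f u.
Proof.
elim: s => [|u s [IHs1 IHs2]] /=; first by split=> // -[].
split=> [[<-|/IHs1[u' su' ->]]|[u']].
- by exists u; rewrite ?mem_head.
- by exists u' => //; rewrite inE su' orbT.
- by rewrite inE => /predU1P[-> ->|su' vE]; [left|right; apply: IHs2; exists u'].
Qed.

Section FlatPoly.
Variables (R S : comNzRingType) (T : set R) (phi : {rmorphism R -> S}).
Hypotheses (subT : subring_set T) (flatT : flat_on T phi).
Local Notation "p ^phi" := (map_poly phi p) (at level 2, format "p ^phi").
Implicit Types p q : {poly R}.

Definition poly_in (p : {poly R}) : Prop := forall k, T p`_k.

Lemma poly_inC c : T c -> poly_in c%:P.
Proof. by move=> Tc k; rewrite coefC; case: ifP => // _; apply: (subring_set0 subT). Qed.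
Lemma poly_inX : poly_in 'X.
Proof.
by move=> k; rewrite coefX; case: eqP => _; [apply: (subring_set1 subT)|apply: (subring_set0 subT)].
Qed.
Lemma poly_inB p q : poly_in p -> poly_in q -> poly_in (p - q).
Proof. by move=> pT qT k; rewrite coefB; apply: subring_setB. Qed.
Lemma poly_inM p q : poly_in p -> poly_in q -> poly_in (p * q).
Proof.
move=> pT qT k; rewrite coefM; apply: (subring_set_sum subT) => j _.
exact: subring_setM.
Qed.
(** Flatness passes to polynomial rings: comparing coefficients gives finitely many relations over
    [T] among the coefficients of the [E i]. The new generators [y] can be taken constant. *)
Lemma flat_on_poly (I : finType) (P : I -> {poly R}) (E : I -> {poly S}) :
  (forall i, poly_in (P i)) -> \sum_i (P i)^phi * E i = 0 ->
  exists (J : finType) (W : I -> J -> {poly R}) (y : J -> S),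
    [/\ forall i l, poly_in (W i l), forall i, E i = \sum_l y l *: (W i l)^phi
      & forall l, \sum_i P i * W i l = 0].
Proof.
move=> PT PE0; pose d := (\sum_i size (E i))%N.
have EE i : E i = \sum_(k < d) (E i)`_k *: 'X^k.
  rewrite -poly_def; apply/polyP => k; rewrite coef_poly.
  case: ltnP => // dk; rewrite nth_default //; apply: leq_trans dk.
  by rewrite /d (bigD1 i) //= leq_addr.
(* The relation [r k] expresses that the coefficient of degree [k] vanishes; from degree [M] on it
   is trivial. *)
pose r k (u : I * 'I_d) := (P u.1 * 'X^(u.2))`_k.
pose M := (\sum_i size (P i) + d)%N.
have rT k u : T (r k u).
  by rewrite /r coefMXn; case: ifP => _; [apply: (subring_set0 subT)|apply: PT].
have rM k u : (M <= k)%N -> r k u = 0.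
  move=> Mk; rewrite /r nth_default //; apply: leq_trans Mk.
  apply: leq_trans (size_polyMleq _ _) _; rewrite size_polyXn addnS /=.
  apply: leq_add; last exact: ltnW.
  by rewrite (bigD1 u.1) //= leq_addr.
have rE k : \sum_u phi (r k u) * (E u.1)`_(u.2) = 0.
  transitivity ((\sum_i (P i)^phi * E i)`_k); last by rewrite PE0 coef0.
  rewrite coef_sum.
  apply: etrans (esym (pair_bigA _ (fun i (n : 'I_d) => phi (r k (i, n)) * (E i)`_n))) _.
  apply: eq_bigr => i _; rewrite [in RHS]EE mulr_sumr coef_sum; apply: eq_bigr => n _.
  by rewrite -scalerAr coefZ mulrC /r /= -coef_map rmorphM /= map_polyXn.
have [|J [W [y [WT EW rW]]]] := flat_on_system (subring_set0 subT) (subring_set1 subT)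
    (subring_setD subT) (subring_setM subT) flatT (x := fun u : I * 'I_d => (E u.1)`_(u.2))
    (rs := [seq r k | k <- iota 0 M]).
  by move=> _ /List_In_map[k _ ->]; split.
have {}rW k l : \sum_u r k u * W u l = 0.
  have [kM|Mk] := ltnP k M; last by rewrite big1 // => u _; rewrite rM ?mul0r.
  by apply: rW; apply/List_In_map; exists k; rewrite ?mem_iota.
exists J, (fun i l => \sum_(k < d) W (i, k) l *: 'X^k), y; split=> [i l k|i|l].
- rewrite coef_sum; apply: (subring_set_sum subT) => n _.
  by rewrite coefZ coefXn; apply: subring_setM => //; case: eqP => _;
    [apply: (subring_set1 subT)|apply: (subring_set0 subT)].
- rewrite EE; under eq_bigr => k _ do rewrite (EW (i, k)) scaler_suml.
  rewrite exchange_big /=; apply: eq_bigr => l _; rewrite rmorph_sum scaler_sumr.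
  apply: eq_bigr => k _.
  by rewrite /= map_polyZ map_polyXn scalerA mulrC.
- apply/polyP => k; rewrite coef0; apply: etrans (rW k l); rewrite coef_sum.
  rewrite [RHS](eq_bigr (fun u => r k (u.1, u.2) * W (u.1, u.2) l)) => [|[]//].
  rewrite -(pair_bigA _ (fun i (n : 'I_d) => r k (i, n) * W (i, n) l)) /=.
  apply: eq_bigr => i _; rewrite mulr_sumr coef_sum; apply: eq_bigr => n _.
  by rewrite -scalerAr coefZ mulrC.
Qed.

(** The subring T[t] localized inside [R] at those of its elements that are units of [R]; this makes
    it closed under inverses. *)
Definition adjoin (t : R) : set R :=
  [set x | exists p v q, [/\ poly_in p, poly_in q, v * q.[t] = 1 & x = p.[t] * v]].

Lemma adjoin_horner t p : poly_in p -> adjoin t p.[t].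
Proof.
move=> pT; exists p, 1, 1%:P; rewrite !hornerC !mulr1; split=> //.
by apply: poly_inC; apply: subring_set1.
Qed.

Lemma adjoin_sub t : T `<=` adjoin t.
Proof.
by move=> x Tx; rewrite -(hornerC x t); apply/adjoin_horner/poly_inC.
Qed.

Lemma adjoin_mem t : adjoin t t.
Proof.
by rewrite -{2}(hornerX t); apply/adjoin_horner/poly_inX.
Qed.

Lemma adjoin_subring t : subring_set (adjoin t).
Proof.
split; first by apply: adjoin_sub; apply: subring_set1.
- move=> _ _ [p [v [q [pT qT vq ->]]]] [p' [v' [q' [pT' qT' vq' ->]]]].
  exists (p * q' - p' * q), (v * v'), (q * q').
  split; [by apply: poly_inB; apply: poly_inM|exact: poly_inM| |].
    by rewrite hornerM mulrACA vq vq' mulr1.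
  rewrite hornerD hornerN !hornerM mulrBl; congr (_ - _).
    by rewrite mulrACA [q'.[t] * _]mulrC vq' mulr1.
  by rewrite [v * v']mulrC mulrACA [q.[t] * _]mulrC vq mulr1.
- move=> _ _ [p [v [q [pT qT vq ->]]]] [p' [v' [q' [pT' qT' vq' ->]]]].
  exists (p * p'), (v * v'), (q * q').
  split; [exact: poly_inM|exact: poly_inM| |].
    by rewrite hornerM mulrACA vq vq' mulr1.
  by rewrite hornerM mulrACA.
Qed.

Lemma adjoin_inv t x y : adjoin t x -> x * y = 1 -> adjoin t y.
Proof.
move=> [p [v [q [pT qT vq ->]]]] pvy; exists q, (y * v), p; split=> //.
  by rewrite mulrC mulrA mulrAC -[RHS]pvy mulrAC.
by rewrite mulrCA [q.[t] * v]mulrC vq mulr1.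
Qed.

(* Over S, f = ('X - phi t) * g with g.[phi t] a unit: multiplying a relation  *)
(* sum_i p_i(t) b_i = 0 by g turns it into sum_i p_i b_i g = f h in {poly S},  *)
(* a relation whose coefficients p_i and f lie in T.                           *)
Lemma flat_on_adjoin t f :
  poly_in f -> f.[t] = 0 -> is_unit f^`().[t] -> flat_on (adjoin t) phi.
Proof.
move=> fT ft [w f'w] I a x aT ax0; pose b := phi t.
have /factor_theorem[g fg] : root f^phi b by rewrite /root horner_map ft rmorph0.
(* The derivative of ('X - b) g at b is g(b), so simplicity of the root makes g(b) a unit. *)
have gw : g.[b] * phi w = 1.
  rewrite -(rmorph1 phi) -f'w rmorphM -horner_map -deriv_map fg; congr (_ * _).
  by rewrite derivM derivXsubC hornerD !hornerM hornerXsubC subrr mulr0 add0r hornerC mulr1.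
have /choice[p /choice[v /choice[q pvq]]] := aT.
have px0 : \sum_i phi (p i).[t] * (phi (v i) * x i) = 0.
  rewrite -[RHS]ax0; apply: eq_bigr => i _; have [_ _ _ ->] := pvq i.
  by rewrite rmorphM mulrA.
have /factor_theorem[h hE] : root (\sum_i (phi (v i) * x i) *: (p i)^phi) b.
  rewrite /root horner_sum -[X in _ == X]px0; apply/eqP/eq_bigr => i _.
  by rewrite hornerZ horner_map mulrC.
(* The additional index carries [f] with coefficient [- h]. *)
have [|| J [W [y [WT EW PW]]]] := flat_on_poly
    (P := fun o : unit + I => if o is inr i then p i else f)
    (E := fun o => if o is inr i then (phi (v i) * x i) *: g else - h).
- by case=> // i; case: (pvq i).
- have := congr1 (fun r => r * g) hE; rewrite mulrAC -mulrA -fg mulr_suml.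
  rewrite big_sumType /= (big_pred1 tt) => [|[]//]; rewrite mulrN [f^phi * h]mulrC => <-.
  rewrite addrC; apply/eqP.
  rewrite subr_eq0; apply/eqP/eq_bigr => i _.
  by rewrite -scalerAl -scalerAr.
(* Evaluation at the root kills the [f] term; [phi w] cancels g(b) and [q i] cancels the denominator
   [v i]. *)
exists J, (fun i l => (q i).[t] * (W (inr i) l).[t]), (fun l => phi w * y l); split.
- move=> i l; have [_ qT _ _] := pvq i.
  by apply: (subring_setM (adjoin_subring t)); apply: adjoin_horner.
- move=> i; have [_ _ vq _] := pvq i.
  have := congr1 (fun r : {poly S} => phi (q i).[t] * phi w * r.[b]) (EW (inr i)).
  rewrite hornerZ horner_sum => E.
  transitivity (phi (q i).[t] * phi w * (phi (v i) * x i * g.[b])).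
    rewrite -[LHS]mul1r -(rmorph1 phi) -vq rmorphM -[LHS]mul1r -gw.
    by rewrite /b; ring.
  rewrite E mulr_sumr; apply: eq_bigr => l _; rewrite hornerZ horner_map rmorphM.
  by rewrite /b; ring.
- move=> l; have := congr1 (fun r : {poly R} => r.[t]) (PW l).
  rewrite horner_sum big_sumType /= (big_pred1 tt) => [|[]//].
  rewrite hornerM ft mul0r add0r horner0 => E.
  rewrite -[RHS]E; apply: eq_bigr => i _; have [_ _ vq ->] := pvq i.
  by rewrite mulrA -(mulrA _ (v i)) vq mulr1 hornerM.
Qed.
End FlatPoly.

(** * Henselization *)

Lemma rmorphism_of (A B : comPzRingType) (f : A -> B) :
  zmod_morphism f -> monoid_morphism f -> exists g : {rmorphism A -> B}, g =1 f.
Proof.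
move=> fB fM; pose fz := GRing.isZmodMorphism.Build A B f fB.
pose fm := GRing.isMonoidMorphism.Build A B f fM.
by exists (HB.pack_for {rmorphism A -> B} f fz fm).
Qed.

Lemma ideal_horner_sub (R : comNzRingType) (I : ideal R) (p : {poly R}) x y :
  I (x - y) -> I (p.[x] - p.[y]).
Proof.
move=> Ixy; elim/poly_ind: p => [|p c IHp]; first by rewrite !horner0 subrr; apply: ideal0.
rewrite !hornerMXaddC opprD addrACA subrr addr0.
have -> : p.[x] * x - p.[y] * y = x * (p.[x] - p.[y]) + p.[y] * (x - y).
  by rewrite !mulrBr [x * _]mulrC [x * _]mulrC addrA subrK.
by apply: idealD; apply: idealMl.
Qed.

Section Subring.
Variables (R : comNzRingType) (T : set R).
Hypothesis subT : subring_set T.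

Definition subring_pred : {pred R} := fun x => `[< T x >].

Lemma subring_pred_closed : subring_closed subring_pred.
Proof.
split=> [|x y /asboolP Tx /asboolP Ty|x y /asboolP Tx /asboolP Ty]; apply/asboolP.
- exact: subring_set1.
- exact: subring_setB.
- exact: subring_setM.
Qed.

HB.instance Definition _ :=
  GRing.isSubringClosed.Build R subring_pred subring_pred_closed.

(* The unused proof argument lets canonical structures recover [subT]. *)
Definition subring_of (_ : subring_set T) : Type := {x : R | subring_pred x}.
Local Notation subring := (subring_of subT).
HB.instance Definition _ := SubType.on subring.
HB.instance Definition _ := [Choice of subring by <:].
HB.instance Definition _ := [SubChoice_isSubComNzRing of subring by <:].

Definition subring_val (x : subring) : R := val x.
Arguments subring_val : simpl never.

Lemma subring_val_zmod_morphism : zmod_morphism subring_val.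
Proof. exact: raddfB. Qed.
Lemma subring_val_monoid_morphism : monoid_morphism subring_val.
Proof. by split=> [|x y]; rewrite /subring_val ?rmorph1 ?rmorphM. Qed.
HB.instance Definition _ :=
  GRing.isZmodMorphism.Build subring R subring_val subring_val_zmod_morphism.
HB.instance Definition _ :=
  GRing.isMonoidMorphism.Build subring R subring_val subring_val_monoid_morphism.

Lemma subring_valP (x : subring) : T (subring_val x).
Proof. exact/asboolP/(valP x). Qed.

Lemma subring_lift x : T x -> exists y : subring, subring_val y = x.
Proof. by move=> /asboolP Tx; exists (Sub x Tx); apply: SubK. Qed.

Lemma subring_val_inj : injective subring_val.
Proof. exact: val_inj. Qed.

Lemma subring_corestrict (A : comNzRingType) (f : {rmorphism A -> R}) :
  (forall a, T (f a)) -> exists g : {rmorphism A -> subring}, forall a, subring_val (g a) = f a.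
Proof.
move=> Tf; have /choice[g gE] : forall a, exists y, subring_val y = f a.
  by move=> a; apply/subring_lift/Tf.
have [||h hg] := @rmorphism_of A subring g.
- by move=> a b; apply: subring_val_inj; rewrite gE [RHS]rmorphB /= !gE -rmorphB.
- split=> [|a b]; apply: subring_val_inj; first by rewrite gE !rmorph1.
  by rewrite gE [RHS]rmorphM /= !gE -rmorphM.
by exists h => a; rewrite hg.
Qed.

Variable m : ideal R.
Hypotheses (henselR : henselian m) (invT : forall x y, T x -> x * y = 1 -> T y).
Hypothesis rootT : forall f t,
  poly_in T f -> f.[t] = 0 -> is_unit f^`().[t] -> T t.

Lemma subring_ideal_subproof : is_ideal [set x : subring | m (subring_val x)].
Proof.
split=> [|x y|a x] /=; first by rewrite rmorph0; apply: ideal0.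
  by rewrite rmorphD; apply: idealD.
by rewrite rmorphM; apply: idealMl.
Qed.

Definition subring_ideal : ideal subring := Ideal subring_ideal_subproof.

(** A simple root modulo the ideal lifts to [R], where it is still simple, so [rootT] places it in
    [T]. Closure under inverses makes the subring local. *)
Lemma subring_henselian : henselian subring_ideal.
Proof.
have [locm rootm] := henselR; split.
  apply: local_ring_nonunits => [x|/=]; last first.
    by rewrite rmorph1 (local_nonunitP _ locm); apply; exists 1; rewrite mulr1.
  rewrite /= (local_nonunitP _ locm); split=> xN; first by move=> /(rmorph_is_unit subring_val).
  move=> [y xy]; apply: xN; have [z zE] := subring_lift (invT (subring_valP x) xy).
  by exists z; apply: subring_val_inj; rewrite rmorphM rmorph1 /= zE.
move=> f a0 fmon /= fa0 f'a0.
pose F := map_poly subring_val f.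
have [|||t Ft ta0] := rootm F (subring_val a0).
- exact: monic_map.
- by rewrite /F horner_map.
- by rewrite /F deriv_map horner_map.
have F't : is_unit F^`().[t].
  apply/(local_unitP _ locm) => mt; apply: f'a0; rewrite -horner_map -deriv_map.
  rewrite -[X in m X](subKr F^`().[t]); apply: idealB => //.
  exact: ideal_horner_sub.
have [|s sE] := subring_lift (rootT (f := F) (t := t) _ Ft F't).
  by move=> k; rewrite coef_map; apply: subring_valP.
exists s; last by rewrite /= rmorphB /= sE.
by apply: subring_val_inj; rewrite rmorph0 -horner_map /= sE; apply: Ft.
Qed.

End Subring.

(** Serves to place all coefficients of a relation in one member of a chain, so that flatness passes
    to unions of chains. *)
Lemma total_on_family (U : Type) (F : set (set U)) (I : finType) (a : I -> U) :
  F !=set0 -> total_on F subset -> (forall i, (\bigcup_(X in F) X) (a i)) ->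
  exists2 X, F X & forall i, X (a i).
Proof.
move=> [X0 FX0] Ftot Fa.
suff [X FX Xa] : exists2 X, F X & forall i, i \in enum I -> X (a i).
  by exists X => // i; apply: Xa; rewrite mem_enum.
elim: (enum I) => [|i s [X FX Xs]]; first by exists X0.
have [Y FY Ya] := Fa i; have [XY|YX] := Ftot _ _ FX FY.
  by exists Y => // k; rewrite inE => /predU1P[->//|/Xs/XY].
by exists X => // k; rewrite inE => /predU1P[->|/Xs//]; apply: YX.
Qed.

Section Henselization.
Variables (A H S : comNzRingType) (mA : ideal A) (mH : ideal H).
Variables (i : {rmorphism A -> H}) (j : {rmorphism H -> S}).
Hypothesis henselization : is_henselization mA mH i.
Hypothesis locA : local_ring mA.

Definition flat_subring (T : set H) : Prop :=
  [/\ range i `<=` T, subring_set T, forall x y, T x -> x * y = 1 -> T y & flat_on T j].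

Lemma flat_subring_full (T : set H) : flat_subring T ->
  (forall U, flat_subring U -> T `<=` U -> U `<=` T) -> forall x, T x.
Proof.
move=> [iT subT invT flatT] Tmax.
have [henselH loci univ] := henselization.
have rootT f t : poly_in T f -> f.[t] = 0 -> is_unit f^`().[t] -> T t.
  move=> fT ft f't; apply: (Tmax (adjoin T t)); [|exact: adjoin_sub|exact: adjoin_mem].
  split; [|exact: adjoin_subring|by move=> x y; apply: adjoin_inv|exact: flat_on_adjoin f't].
  by move=> x /iT Tx; apply: adjoin_sub.
have henselT := subring_henselian subT henselH invT rootT.
have [|i' i'E] := subring_corestrict subT (f := i); first by move=> a; apply: iT; exists a.
have [|g [locg gi' _]] := univ _ _ i' henselT; first by move=> a /loci; rewrite /= i'E.
have [h [_ _ huniq]] := univ _ _ i henselH loci.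
(* The identity and the composite of [g] with the inclusion of [T] are local endomorphisms of [H]
   under [A]; by uniqueness both equal [h]. *)
move=> x; have -> : x = h x by apply: (huniq (idfun : {rmorphism H -> H})).
have <- : subring_val (g x) = h x.
  apply: (huniq (@subring_val _ _ subT \o g : {rmorphism H -> H})) => [//|a].
  by rewrite -i'E -gi'.
exact: subring_valP.
Qed.

Lemma henselization_flat : flat_on (range i) j -> flat_on setT j.
Proof.
have [henselH loci univ] := henselization; have [locH _] := henselH.
move=> flati.
have gi : flat_subring (range i).
  split=> //.
    split=> [|_ _ [a _ <-] [b _ <-]|_ _ [a _ <-] [b _ <-]].
    - by exists 1; rewrite ?rmorph1.
    - by exists (a - b); rewrite ?rmorphB.
    - by exists (a * b); rewrite ?rmorphM.
  (* Closure under inverses: [i] is local, so an element of [A] whose image is a unit is a unit. *)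
  move=> _ y [a _ <-] ay.
  have [b ab] : is_unit a.
    apply/(local_unitP _ locA) => /loci/(local_nonunitP _ locH); apply.
    by exists y.
  exists b => //; rewrite -[i b]mulr1 -ay mulrA -rmorphM [b * a]mulrC ab rmorph1.
  by rewrite mul1r.
(* The empty set again accounts for the empty chain. *)
pose P (X : set H) := X = set0 \/ flat_subring X.
have [F FP Ftot|T [PT Tmax]] := @Zorn_bigcup H P.
  have [[X0 FX0 [y0 X0y]]|F0] := pselect (exists2 X, F X & X !=set0); last first.
    by left; apply/seteqP; split=> // y [X FX Xy]; case: F0; exists X => //; exists y.
  have FI X y : F X -> X y -> flat_subring X.
    by move=> FX Xy; have [X_0|//] := FP X FX; rewrite X_0 in Xy.
  have two x y : (\bigcup_(X in F) X) x -> (\bigcup_(X in F) X) y ->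
      exists X, [/\ F X, X x & X y].
    move=> Fx Fy; have [||[]|X FX Xxy] := total_on_family (F := F)
      (a := fun b : bool => if b then x else y) => //; first by exists X0.
    by exists X; split=> //; [apply: (Xxy true)|apply: (Xxy false)].
  right; have [iX0 [X01 _ _] _ _] := FI _ _ FX0 X0y; split.
  - by move=> x /iX0 X0x; exists X0.
  - split; first by exists X0.
      move=> x y Fx /(two _ _ Fx)[X [FX Xx Xy]]; exists X => //.
      by have [_ subX _ _] := FI _ _ FX Xx; apply: subring_setB.
    move=> x y Fx /(two _ _ Fx)[X [FX Xx Xy]]; exists X => //.
    by have [_ subX _ _] := FI _ _ FX Xx; apply: subring_setM.
  - move=> x y [X FX Xx] xy; exists X => //.
    by have [_ _ invX _] := FI _ _ FX Xx; apply: invX xy.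
  - move=> I a x Fa ax0.
    (* Adding [y0] to the family keeps the chosen [X] nonempty even if [I] is empty. *)
    have [||[[]|k]|X FX Xa] := total_on_family (F := F)
      (a := fun o : unit + I => if o is inr k then a k else y0) => //.
    - by exists X0.
    - by exists X0.
    have [_ _ _ flatX] := FI _ _ FX (Xa (inl tt)).
    have [J [W [y [XW xW aW]]]] := flatX _ _ _ (fun k => Xa (inr k)) ax0.
    by exists J, W, y; split=> // k l; exists X.
have gT : flat_subring T.
  case: PT => // T0; case: (Tmax (range i)); last by right.
  by rewrite T0; split=> [|/(_ (i 0))]; [exact: sub0set|apply; exists 0].
have TT : T = setT.
  apply/seteqP; split=> // x _; apply: (flat_subring_full gT) => U gU TU.
  by apply: contrapT => UT; apply: (Tmax U) => //; right.
by have [_ _ _] := gT; rewrite TT.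
Qed.
End Henselization.

(** * Weierstrass extensions *)

(** A relation over [A] is first solved in [S]. The equations expressing the [g (x i)] through [y]
    form a system over [R] in the unknowns 1 and [y], which flatness of [g] solves in turn. *)
Lemma flat_on_descent (A R S : comPzRingType) (f : {rmorphism A -> R})
    (g : {rmorphism R -> S}) (h : {rmorphism A -> S}) :
  g \o f =1 h -> flat_on setT h -> flat_on setT g -> reflects_unimodular g ->
  flat_on setT f.
Proof.
move=> gfh flath flatg uni I a x _ ax0.
have [||J [W [y [_ xW aW]]]] := flath I a (fun i => g (x i)) => //.
  rewrite -[RHS](rmorph0 g) -ax0 rmorph_sum; apply: eq_bigr => i _.
  by rewrite rmorphM -gfh.
pose r i (o : unit + J) := if o is inr l then f (W i l) else - x i.
have [||||i|K [V [z [_ VE rV]]]] := flat_on_system (T := setT) _ _ _ _ flatg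
    (x := fun o : unit + J => if o is inr l then y l else 1) (rs := [seq r i | i <- enum I]).
- by [].
- by [].
- by [].
- by [].
- move=> /List_In_map[k _ ->]; split=> //.
  rewrite big_sumType /= (big_pred1 tt) => [|[]//]; rewrite rmorphN mulr1 xW addrC.
  by apply/eqP; rewrite subr_eq0; apply/eqP/eq_bigr => l _; rewrite -gfh.
(* The row of [V] belonging to 1 is unimodular; contracting the other rows with [d] replaces [y] by
   elements of [R]. *)
have [d Vd] := uni _ _ _ (esym (VE (inl tt))).
exists J, W, (fun l => \sum_k V (inr l) k * d k); split=> // i.
rewrite -[x i]mulr1 -Vd mulr_sumr; under [RHS]eq_bigr => l _ do rewrite mulr_sumr.
rewrite exchange_big /=; apply: eq_bigr => k _.
have := rV (r i); rewrite List_In_map => /(_ (ex_intro2 _ _ i (mem_enum _ i) erefl) k).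
rewrite big_sumType /= (big_pred1 tt) => [|[]//]; rewrite mulNr => /eqP.
rewrite addrC subr_eq0 => /eqP xV; rewrite mulrA -xV mulr_suml.
by apply: eq_bigr => l _; rewrite mulrA.
Qed.

Lemma flat_on_range (A R S : comPzRingType) (f : {rmorphism A -> R})
    (g : {rmorphism R -> S}) (h : {rmorphism A -> S}) :
  g \o f =1 h -> flat_on setT h -> flat_on (range f) g.
Proof.
move=> gfh flath I a x aT ax0.
have /choice[a' a'E] : forall i, exists a', f a' = a i by move=> i; case: (aT i) => b; exists b.
have [||J [W [y [_ xW aW]]]] := flath I a' x => //.
  by rewrite -[RHS]ax0; apply: eq_bigr => i _; rewrite -gfh /= a'E.
exists J, (fun i l => f (W i l)), y; split=> [i l|i|l]; first by exists (W i l).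
  by rewrite xW; apply: eq_bigr => l _; rewrite -gfh.
rewrite -[RHS](rmorph0 f) -(aW l) rmorph_sum; apply: eq_bigr => i _.
by rewrite rmorphM a'E.
Qed.

Lemma ideal_gen1P (R : comPzRingType) (a x : R) :
  ideal_gen [set a] x -> exists w, x = a * w.
Proof.
have aid : is_ideal [set x | exists w, x = a * w].
  split=> [|_ _ [v ->] [w ->]|c _ [w ->]]; first by exists 0; rewrite mulr0.
    by exists (v + w); rewrite mulrDr.
  by exists (c * w); rewrite mulrCA.
by apply: (ideal_gen_sub (I := Ideal aid)) => _ ->; exists 1; rewrite mulr1.
Qed.

Lemma faithfully_flat_dvd (R S : comPzRingType) (phi : {rmorphism R -> S}) a x s :
  faithfully_flat phi -> phi x = phi a * s -> exists w, x = a * w.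
Proof.
move=> ff xE; apply: ideal_gen1P.
apply: (faithfully_flat_contraction ff (J := unit) (c := fun=> a) (z := fun=> s)).
  by move=> _; apply: ideal_gen_self.
by rewrite (big_pred1 tt) // => -[].
Qed.

Lemma faithfully_flat_local_hom (R S : comPzRingType) (mR : ideal R) (mS : ideal S)
    (phi : {rmorphism R -> S}) :
  local_ring mR -> local_ring mS -> faithfully_flat phi -> local_hom mR mS phi.
Proof.
move=> locR locS ff x /(local_nonunitP _ locR) xN.
apply/(local_nonunitP _ locS) => -[s xs]; apply: xN.
have [|w xw] := faithfully_flat_dvd (a := x) (x := 1) (s := s) ff.
  by rewrite rmorph1 xs.
by exists w.
Qed.

(** In [S], the images of [t] and [f a] differ by a unit, so by faithful flatness they divide each
    other in [R]. In a local ring such elements differ by a unit. *)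
Lemma weierstrass_factor (A R S : comPzRingType) (mR : ideal R) (f : {rmorphism A -> R})
    (g : {rmorphism R -> S}) (h : {rmorphism A -> S}) :
  g \o f =1 h -> local_ring mR -> faithfully_flat g -> weierstrass h -> weierstrass f.
Proof.
move=> gfh locR ff wh t; have [a [s [[s' ss'] tE]]] := wh (g t).
have [w tw] : exists w, t = f a * w.
  by apply: (faithfully_flat_dvd (s := s) ff); rewrite tE -gfh.
have [w' aw'] : exists w', f a = t * w'.
  by apply: (faithfully_flat_dvd (s := s') ff); rewrite tE -mulrA ss' mulr1 -gfh.
exists a; have [wU|wN] := pselect (is_unit w); first by exists w.
exists 1; split; first by exists 1; rewrite mulr1.
(* If [w] is not a unit, t (1 - w' w) = 0 forces [t] and [f a] to vanish, and the unit 1 serves. *)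
have [v v1] : is_unit (1 - w' * w).
  apply: (local_sub locR (x := 1)); last by exists 1; rewrite mulr1.
  by rewrite subKr; apply: idealMl; apply/(local_nonunitP _ locR).
have t0 : t = 0.
  rewrite -[t]mulr1 -v1 mulrA mulrBr mulr1 mulrA -aw' -tw subrr.
  by rewrite mul0r.
by rewrite aw' t0 !mul0r.
Qed.

(** Elementwise form of principality of the ideal (x, y), with generator [z]. *)
Definition bezout (R : comPzRingType) (x y : R) : Prop :=
  exists z, [/\ exists u v, z = u * x + v * y, exists u, x = u * z & exists u, y = u * z].

Lemma bezout_principal (R : comPzRingType) :
  noetherian R -> (forall x y : R, bezout x y) -> principal_ideal_ring R.
Proof.
move=> noethR bez I; have [s ->] := noethR I.
suff [z sz zs] : exists2 z, ideal_gen [set x | x \in s] z &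
    forall x, x \in s -> exists u, x = u * z.
  exists z; apply/seteqP; split; apply: ideal_gen_sub => x /=; last by move=> ->.
  by move=> /zs[u ->]; apply: (idealMl (I := ideal_gen [set z])); apply: ideal_gen_self.
elim: s {I} => [|x s [z sz zs]]; first by exists 0 => //; apply: ideal0.
have [y [[u [v yE]] [u' xy] [v' zy]]] := bez x z.
exists y => [|w].
  rewrite yE; apply: idealD; apply: idealMl; first by apply: ideal_gen_self; apply: mem_head.
  by apply: ideal_gen_sub sz => w ws; apply: ideal_gen_self; rewrite /= inE ws orbT.
rewrite inE => /predU1P[->|/zs[w' ->]]; first by exists u'.
by exists (w' * v'); rewrite {1}zy mulrA.
Qed.

(** * Residue field of a Weierstrass extension and its embedding in the completion *)

Section WeierstrassExtension.
Variables (A B : comNzRingType) (mA : ideal A) (mB : ideal B) (iota : {rmorphism A -> B}).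
Hypotheses (locA : local_ring mA) (locB : local_ring mB).
Hypotheses (ff : faithfully_flat iota) (weier : weierstrass iota).

Lemma weierstrass_maximal b : mB b -> exists a u, [/\ mA a, is_unit u & b = iota a * u].
Proof.
move=> mb; have [a [u [uU bE]]] := weier b; exists a, u; split=> //.
apply: contrapT => /(local_unitP _ locA)[a' aa'].
move: mb => /(local_nonunitP _ locB); apply; rewrite bE.
have [u' uu'] := uU; exists (iota a' * u').
by rewrite mulrACA -rmorphM aa' rmorph1 uu' mulr1.
Qed.

Lemma residue_surjective :
  noetherian B -> ~ principal_ideal_ring B -> forall b, exists a, mB (b - iota a).
Proof.
move=> noethB nPIR b.
(* Changing generators by units does not affect principality, so the non-principal pair can be taken
   from [A]. *)
have [p [q pq]] : exists p q, ~ bezout (iota p) (iota q).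
  apply: contrapT => bez; apply: nPIR; apply: bezout_principal => // x y.
  have [p [u [[u' uu'] ->]]] := weier x; have [q [v [[v' vv'] ->]]] := weier y.
  have [z [[s [t zE]] [s' pE] [t' qE]]] : bezout (iota p) (iota q).
    by apply: contrapT => pq; apply: bez; exists p, q.
  exists z; split; last 2 first.
  - by exists (s' * u); rewrite pE mulrAC.
  - by exists (t' * v); rewrite qE mulrAC.
  exists (s * u'), (t * v'); rewrite zE; congr (_ + _).
    by rewrite -[LHS]mulr1 -uu'; ring.
  by rewrite -[LHS]mulr1 -vv'; ring.
have [a [u [[u' uu'] aE]]] := weier (iota p + b * iota q).
have [c [d adE]] : exists c d, a = c * p + d * q.
  have Iid : is_ideal [set a | exists c d, a = c * p + d * q].
    split=> [|_ _ [c [d ->]] [c' [d' ->]]|e _ [c [d ->]]].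
    - by exists 0, 0; rewrite !mul0r addr0.
    - by exists (c + c'), (d + d'); ring.
    - by exists (e * c), (e * d); ring.
  apply: (faithfully_flat_contraction ff (I := Ideal Iid) (J := bool)
    (c := fun k => if k then p else q) (z := fun k => if k then u' else b * u')).
    by case; [exists 1, 0 | exists 0, 1]; rewrite mul1r mul0r ?addr0 ?add0r.
  rewrite big_bool /= -[iota a]mulr1 -uu' mulrA -aE; ring.
(* This compares p + b q = a u, multiplied by the inverse u' of u, with a = c p + d q. *)
have key : (u' - iota c) * iota p = (iota d - b * u') * iota q.
  have : (iota p + b * iota q) * u' = iota c * iota p + iota d * iota q.
    by rewrite aE -mulrA uu' mulr1 adE rmorphD !rmorphM.
  move=> E; apply/eqP; rewrite -subr_eq0.
  have -> : (u' - iota c) * iota p - (iota d - b * u') * iota q =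
    (iota p + b * iota q) * u' - (iota c * iota p + iota d * iota q) by ring.
  by rewrite E subrr.
(* If a coefficient in [key] were a unit, one of p, q would divide the other and (p, q) would be
   principal. *)
have mc : mB (u' - iota c).
  apply/(local_nonunitP _ locB) => -[e eE]; apply: pq; exists (iota q); split.
  - by exists 0, 1; rewrite mul0r mul1r add0r.
  - exists (e * (iota d - b * u')); rewrite -mulrA -key mulrA [e * _]mulrC eE.
    by rewrite mul1r.
  - by exists 1; rewrite mul1r.
have md : mB (iota d - b * u').
  apply/(local_nonunitP _ locB) => -[e eE]; apply: pq; exists (iota p); split.
  - by exists 1, 0; rewrite mul0r mul1r addr0.
  - by exists 1; rewrite mul1r.
  - exists (e * (u' - iota c)); rewrite -mulrA key mulrA [e * _]mulrC eE.
    by rewrite mul1r.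
(* [c] is congruent to the unit [u'], so b is congruent to d/c. *)
have [c' cc'] : is_unit c.
  apply/(local_unitP _ locA) => /(faithfully_flat_local_hom locA locB ff).
  apply/(local_unitP _ locB); apply: (local_sub locB mc).
  by exists u; rewrite mulrC.
exists (c' * d).
have -> : b - iota (c' * d) =
    - (b * iota c' * (u' - iota c) + iota c' * (iota d - b * u')) .
  rewrite -{1}[b]mulr1 -(rmorph1 iota) -cc' !rmorphM; ring.
by apply: idealN; apply: idealD; apply: idealMl.
Qed.

(** The extension of m_A^n to [B]; by the Weierstrass property single products already form an
    ideal. *)
Definition extended_pow n : set B := [set b | exists x w, ideal_pow mA n x /\ b = iota x * w].

Lemma extended_pow_contraction n a : extended_pow n (iota a) -> ideal_pow mA n a.
Proof.
by move=> [x [w [mx /(faithfully_flat_dvd ff)[v ->]]]]; apply: idealMr.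
Qed.

(** A sum of two products is of the form a u with u a unit, and a lies in the contraction of m_A^n
    B, which is m_A^n. *)
Lemma extended_pow_is_ideal n : is_ideal (extended_pow n).
Proof.
split.
- by exists 0, 0; rewrite mulr0; split=> //; apply: ideal0.
- move=> _ _ [x [w [mx ->]]] [x' [w' [mx' ->]]].
  have [a [u [[u' uu'] aE]]] := weier (iota x * w + iota x' * w').
  exists a, u; split=> //.
  apply: (faithfully_flat_contraction ff (J := bool)
    (c := fun k => if k then x else x') (z := fun k => if k then w * u' else w' * u')).
    by case.
  rewrite big_bool /= -[iota a]mulr1 -uu' mulrA -aE; ring.
- by move=> a _ [x [w [mx ->]]]; exists x, (a * w); rewrite mulrCA.
Qed.

Definition extended_ideal n : ideal B := Ideal (extended_pow_is_ideal n).

Hypothesis residue : forall b, exists a, mB (b - iota a).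

(** Successive approximation: the cofactor [w] of the error is congruent modulo m_B to an element of
    [A], and m_B is generated by m_A by the Weierstrass property. *)
Lemma extended_pow_approx n b : exists a, extended_ideal n (b - iota a).
Proof.
elim: n => [|n [a [x [w [mx bE]]]]].
  by exists 0, 1, b; rewrite rmorph0 rmorph1 subr0 mul1r; split=> //; apply: ideal_pow0.
have [a' /weierstrass_maximal[y [u [my _ wE]]]] := residue w.
exists (a + x * a'), (y * x), u; split; first exact: ideal_powS_mul.
by rewrite rmorphD !rmorphM opprD addrA bE -mulrBr wE; ring.
Qed.

Hypothesis noethA : noetherian A.

Lemma completion_embedding : exists k : {rmorphism B -> adic_completion mA},
  ff_embedding k /\ k \o iota =1 adic_of mA.
Proof.
(* [r (n, b)] approximates [b] modulo m_A^n B; by contraction its class modulo m_A^n depends only on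
   [b], and these classes define the map to the completion. *)
have /choice[r rE] : forall nb, exists a, extended_ideal nb.1 (nb.2 - iota a).
  by move=> [n b]; apply: extended_pow_approx.
have r_eq n b a : extended_ideal n (b - iota a) ->
    quot_pi (ideal_pow mA n) (r (n, b)) = quot_pi (ideal_pow mA n) a.
  move=> nba; apply/quot_piP/extended_pow_contraction.
  suff : extended_ideal n (iota (r (n, b) - a)) by [].
  have -> : iota (r (n, b) - a) = (b - iota a) - (b - iota (r (n, b))).
    by rewrite rmorphB; ring.
  by apply: idealB => //; apply: (rE (n, b)).
have extS n : extended_ideal n.+1 `<=` extended_ideal n.
  by move=> _ [x [w [mx ->]]]; exists x, w; split=> //; apply: ideal_pow_sub.
have rcompat b : adic_compatible (fun n => quot_pi (ideal_pow mA n) (r (n, b))).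
  apply: adic_compatibleW => n; exists (r (n.+1, b)) => //.
  by apply/esym/r_eq/extS; apply: (rE (n.+1, b)).
pose f b : adic_completion mA := Adic (rcompat b).
have fE n b a : extended_ideal n (b - iota a) -> f b n = quot_pi (ideal_pow mA n) a.
  exact: r_eq.
have [||k kf] := @rmorphism_of _ _ f.
- move=> b b'; apply: adic_ext => n.
  apply: etrans (fE n _ (r (n, b) - r (n, b')) _) (rmorphB _ _ _).
  have -> : b - b' - iota (r (n, b) - r (n, b')) =
      (b - iota (r (n, b))) - (b' - iota (r (n, b'))) by rewrite rmorphB; ring.
  by apply: idealB; [apply: (rE (n, b))|apply: (rE (n, b'))].
- split=> [|b b']; apply: adic_ext => n.
    by rewrite (fE n _ 1) // rmorph1 subrr; apply: ideal0.
  apply: etrans (fE n _ (r (n, b) * r (n, b')) _) (rmorphM _ _ _).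
  have -> : b * b' - iota (r (n, b) * r (n, b')) =
      b' * (b - iota (r (n, b))) + iota (r (n, b)) * (b' - iota (r (n, b'))).
    by rewrite rmorphM; ring.
  by apply: idealD; apply: idealMl; [apply: (rE (n, b))|apply: (rE (n, b'))].
have kiota a : k (iota a) = adic_of mA a.
  by rewrite kf; apply: adic_ext => n; apply: fE; rewrite subrr; apply: ideal0.
exists k; split=> //; apply: flat_ff_embedding.
(* Writing b_i = a_i u_i moves the units into the unknowns, giving a relation over [A]; the inverses
   of the u_i are put back into the solution. *)
- move=> I b x _ bx0.
  have /choice[a /choice[u uE]] := fun i => weier (b i).
  have /choice[u' uu'] : forall i, exists u', u i * u' = 1 by move=> i; case: (uE i).
  have [||J [W [y [_ xW aW]]]] := completion_flat noethA (I := I) (m := mA)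
      (a := a) (x := fun i => k (u i) * x i) => //.
    rewrite -[RHS]bx0; apply: eq_bigr => i _; have [_ ->] := uE i.
    by rewrite rmorphM kiota mulrA.
  exists J, (fun i l => u' i * iota (W i l)), y; split=> // [i|l].
    rewrite -[LHS]mul1r -(rmorph1 k) -(uu' i) mulrC rmorphM mulrA mulrC [x i * _]mulrC xW.
    by rewrite mulr_sumr; apply: eq_bigr => l _; rewrite rmorphM kiota mulrA.
  rewrite -[RHS](rmorph0 iota) -(aW l) rmorph_sum; apply: eq_bigr => i _.
  by have [_ ->] := uE i; rewrite rmorphM mulrA -(mulrA (iota (a i))) uu' mulr1.
(* The kernel of the projection to A/m_A is a proper ideal into which [k] sends m_B. *)
- have mid : is_ideal [set z : adic_completion mA | z 1%N = 0].
    split=> //= [x y x0 y0|a x x0].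
      by rewrite x0 y0 addr0.
    by rewrite x0 mulr0.
  have quot0 (x : A) : ideal_pow mA 1 x <-> quot_pi (ideal_pow mA 1) x = 0.
    by rewrite -(rmorph0 (quot_pi _)) quot_piP subr0.
  apply: (local_reflects_unimodular (mR := mB) (mS := Ideal mid) locB) => [/=|b /=].
    move=> /quot0 /(ideal_powS_sub (J := mA))m1.
    have [mT _] := locA; case: mT => mT _; apply: mT; apply/seteqP; split=> // x _.
    by apply: ideal1; apply: m1 => y z my _; apply: idealMr.
  move=> /weierstrass_maximal[a [u [ma _ ->]]].
  rewrite kf (fE 1%N _ 0) ?rmorph0 // subr0; exists a, u; split=> //.
  by rewrite -[a]mulr1; apply: ideal_powS_mul => //; apply: ideal_pow0.
Qed.
End WeierstrassExtension.

Theorem proposition4p1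
  (A B : comNzRingType) (mA : ideal A) (mB : ideal B)
  (iota : {rmorphism A -> B})
  (locA : local_ring mA) (locB : local_ring mB)
  (noethA : noetherian A) (noethB : noetherian B)
  (iota_ext : ff_embedding iota)
  (iota_weierstrass : weierstrass iota)
  (henselB : henselian mB)
  (Ah : comNzRingType) (mH : ideal Ah) (i : {rmorphism A -> Ah})
  (i_hensel : is_henselization mA mH i) :
  [/\ ff_embedding i,
      exists j : {rmorphism Ah -> B},
        [/\ ff_embedding j, j \o i =1 iota &
            ~ principal_ideal_ring B ->
            exists k : {rmorphism B -> adic_completion mA},
              ff_embedding k /\ k \o iota =1 adic_of mA]
    & weierstrass i].
Proof.
have [_ ff] := iota_ext; have [[locH _] loci univ] := i_hensel.
have lociota := faithfully_flat_local_hom locA locB ff.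
have [j [locj ji _]] := univ _ _ iota henselB lociota.
have flat_iota := faithfully_flat_flat_on ff.
(* Over the image of [A], flatness of [j] is that of [iota]; the maximal subring argument extends it
   to all of [Ah]. *)
have flatj : flat_on setT j := henselization_flat i_hensel locA (flat_on_range ji flat_iota).
have not1 (R : comNzRingType) (m : ideal R) : local_ring m -> ~ m 1.
  by move=> locm /(local_nonunitP _ locm); apply; exists 1; rewrite mulr1.
have unij := local_reflects_unimodular locH (not1 _ _ locB) locj.
have ffj := flat_ff_embedding flatj unij.
split; last exact: weierstrass_factor ji locH ffj.2 iota_weierstrass.
- apply: flat_ff_embedding (flat_on_descent ji flat_iota flatj unij) _.
  exact: local_reflects_unimodular locA (not1 _ _ locH) loci.
- exists j; split=> // nPIR; apply: (completion_embedding locA locB) => //.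
  exact: (residue_surjective locA locB).
Qed.
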